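(* Suppose $\mathbb{E}_{P_0}K_{P_0}(X,X)<\infty$, Stein's identity $\mathbb{E}_{P_0}\xi_{P_0}(X)=0$ holds, $\operatorname{tr}(C_\star)>0$, and $\mathbb{E}_{P_0}K_{P_0}(X,X)^2<\infty$. Let $X_1,\dots,X_n$ be i.i.d. from $P_0$ with $n\ge n_0:=\bigl\lceil\mathbb{E}_{P_0}K_{P_0}(X,X)^2/\operatorname{tr}(C_\star)^2\bigr\rceil$. Then the ratio of the plug-in's risk at the target to the benchmark $\operatorname{tr}(C_\star^2)^{1/4}/\sqrt n$ satisfies \[ \frac{\mathbb{E}_{P_0}\widehat{\mathrm{KSD}}_V}{\operatorname{tr}(C_\star^2)^{1/4}/\sqrt n}\ \asymp\ \left(\frac{\operatorname{tr}(C_\star)^2}{\operatorname{tr}(C_\star^2)}\right)^{1/4}=r_{\mathrm{eff}}(C_\star)^{1/4}. \]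
   Context: $P_0$ is a fixed probability distribution on $\mathcal{X}\subseteq\mathbb{R}^d$ with a continuously differentiable, everywhere positive density $p_0$; its score is $s_0(x)=\nabla\log p_0(x)$. $k\in C^{1,1}(\mathcal{X}\times\mathcal{X})$ is a positive definite kernel with reproducing kernel Hilbert space $\mathcal{H}_k$, and $\mathcal{H}:=\mathcal{H}_k^d$. The Langevin--Stein feature map is $\xi_{P_0}(x):=s_0(x)k(x,\cdot)+\nabla_x k(x,\cdot)\in\mathcal{H}$, and the Stein kernel is $K_{P_0}(x,y):=\langle\xi_{P_0}(x),\xi_{P_0}(y)\rangle_{\mathcal{H}}$. The plug-in (V-statistic) estimator is \[ \widehat{\mathrm{KSD}}_V:=\Bigl\|\frac1n\sum_{i=1}^n\xi_{P_0}(X_i)\Bigr\|_{\mathcal{H}}=\Bigl(\frac1{n^2}\sum_{i,j=1}^nK_{P_0}(X_i,X_j)\Bigr)^{1/2}. \] The Stein covariance operator is $C_\star:=\mathbb{E}_{P_0}[\xi_{P_0}(X)\otimes\xi_{P_0}(X)]$ on $\mathcal{H}$, where $a\otimes b$ is the operator $x\mapsto\langle b,x\rangle a$; it is positive, self-adjoint and trace class with $\operatorname{tr}(C_\star)=\mathbb{E}_{P_0}K_{P_0}(X,X)$. When $\operatorname{tr}(C_\star^2)>0$, the effective rank is $r_{\mathrm{eff}}(C_\star):=\operatorname{tr}(C_\star)^2/\operatorname{tr}(C_\star^2)$. Notation: $a\lesssim b$ means $a\le Cb$ for an absolute constant $C$, and $a\asymp b$ means $a\lesssim b\lesssim a$.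 $\lceil u\rceil$ is the smallest integer $\ge u$. *)

(* Defs.v *)
From HB Require Import structures.
From mathcomp Require Export all_boot all_order all_algebra.
From mathcomp Require Export all_classical all_reals all_analysis.
From mathcomp Require Export sesquilinear.

Set Implicit Arguments.
Unset Strict Implicit.
Unset Printing Implicit Defensive.

Export Order.TTheory GRing.Theory Num.Theory numFieldNormedType.Exports.

Local Open Scope classical_set_scope.
Local Open Scope ring_scope.

(* R^d is 'rV[R]_d, with its Borel sigma-algebra. *)
HB.instance Definition _ (R : realType) (d : nat) :=
  Measurable.copy 'rV[R]_d (g_sigma_algebraType (@open 'rV[R]_d)).

Section Euclidean.
Variables (R : realType) (d : nat).
Implicit Types (X : set 'rV[R]_d) (x y : 'rV[R]_d).

(* The values on boxes determine the measure on the Borel sets. *)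
Definition is_lebesgue (lam : {measure set 'rV[R]_d -> \bar R}) : Prop :=
  forall a b : 'rV[R]_d, (forall i, a 0 i <= b 0 i) ->
    lam [set x | forall i, a 0 i <= x 0 i <= b 0 i] =
    (\prod_(i < d) (b 0 i - a 0 i))%:E.

Definition has_density X (P : probability 'rV[R]_d R) (p : 'rV[R]_d -> R) :=
  exists2 lam : {measure set 'rV[R]_d -> \bar R}, is_lebesgue lam &
    forall A, measurable A -> P A = (\int[lam]_(x in A `&` X) (p x)%:E)%E.

Definition partial (i : 'I_d) (f : 'rV[R]_d -> R) x : R :=
  'D_(delta_mx 0 i) f x.

Definition has_partial (i : 'I_d) (f : 'rV[R]_d -> R) x : Prop :=
  derivable f x (delta_mx 0 i).

(* For open X. *)
Definition C1_on X (f : 'rV[R]_d -> R) : Prop :=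
  (forall x, X x -> differentiable f x) /\
  (forall i x, X x -> {for x, continuous (partial i f)}).

Definition score (p : 'rV[R]_d -> R) x : 'rV[R]_d :=
  \row_i partial i (fun y => ln (p y)) x.

Section Kernel.
Variables (X : set 'rV[R]_d) (k : 'rV[R]_d -> 'rV[R]_d -> R).

Definition pd_kernel : Prop :=
  (forall x y, X x -> X y -> k x y = k y x) /\
  (forall m (x : 'I_m -> 'rV[R]_d) (c : 'I_m -> R), (forall i, X (x i)) ->
     0 <= \sum_(i < m) \sum_(j < m) c i * c j * k (x i) (x j)).

Definition partial1 (i : 'I_d) (f : 'rV[R]_d -> 'rV[R]_d -> R) x y : R :=
  partial i (f ^~ y) x.

Definition partial2 (j : 'I_d) (f : 'rV[R]_d -> 'rV[R]_d -> R) x y : R :=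
  partial j (f x) y.

Definition continuous_on2 (f : 'rV[R]_d -> 'rV[R]_d -> R) : Prop :=
  forall x y, X x -> X y -> {for (x, y), continuous (fun z => f z.1 z.2)}.

(* One derivative in each argument: the partial derivatives of order at most
   one in x and at most one in y exist and are jointly continuous. For a
   symmetric k the other order of mixed differentiation is obtained by
   exchanging the arguments. *)
Definition C11_on : Prop :=
  [/\ continuous_on2 k,
      forall i, (forall x y, X x -> X y -> has_partial i (k ^~ y) x) /\
                continuous_on2 (partial1 i k),
      forall j, (forall x y, X x -> X y -> has_partial j (k x) y) /\
                continuous_on2 (partial2 j k)
    & forall i j,
        (forall x y, X x -> X y -> has_partial i ((partial2 j k) ^~ y) x) /\
        continuous_on2 (partial1 i (partial2 j k))].

(* A Hilbert space of functions on X: an element h is identified with the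
   restriction to X of rkhs_eval h. Linearity of the evaluation is a
   consequence of the reproducing property. *)
Record rkhs := Rkhs {
  rkhs_space :> completeNormedModType R ;
  rkhs_dot : {dot rkhs_space for idfun} ;
  rkhs_norm : forall h : rkhs_space, rkhs_dot h h = `|h| ^+ 2 ;
  rkhs_eval : rkhs_space -> 'rV[R]_d -> R ;
  rkhs_ext : forall g h : rkhs_space,
    (forall x, X x -> rkhs_eval g x = rkhs_eval h x) -> g = h ;
  rkhs_section : 'rV[R]_d -> rkhs_space ;
  rkhs_sectionE : forall x y, X x -> X y ->
    rkhs_eval (rkhs_section x) y = k x y ;
  rkhs_reproducing : forall (h : rkhs_space) x, X x ->
    rkhs_eval h x = rkhs_dot h (rkhs_section x) }.

End Kernel.
End Euclidean.

Section InnerProduct.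
Variables (R : realType) (V : lmodType R) (dot : V -> V -> R).

Definition dnorm (v : V) : R := Num.sqrt (dot v v).

(* a (x) b *)
Definition rank_one (a b : V) (v : V) : V := dot b v *: a.

(* Orthonormal basis of a Hilbert space: a total orthonormal set. *)
Definition orthonormal_basis (B : set V) : Prop :=
  (forall u v, B u -> B v -> dot u v = (u == v)%:R) /\
  (forall h, (forall b, B b -> dot h b = 0) -> h = 0).

(* Trace, in [0, +oo], of a positive operator. *)
Definition optrace (T : V -> V) : \bar R :=
  \esum_(b in xget set0 orthonormal_basis) (dot (T b) b)%:E.

(* m is the (weak) expectation of the V-valued map f under P, over D. *)
Definition is_vexpect (dd : measure_display) (E : measurableType dd)
    (P : probability E R) (D : set E) (f : E -> V) (m : V) : Prop :=
  forall h, P.-integrable D (fun x => (dot (f x) h)%:E) /\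
            dot m h = \int[P]_(x in D) dot (f x) h.

Definition vexpect (dd : measure_display) (E : measurableType dd)
    (P : probability E R) (D : set E) (f : E -> V) : V :=
  xget 0 (is_vexpect P D f).

End InnerProduct.

Section Stein.
Variables (R : realType) (d : nat) (X : set 'rV[R]_d).
Variables (k : 'rV[R]_d -> 'rV[R]_d -> R) (Hk : rkhs X k).
Variables (p0 : 'rV[R]_d -> R) (P0 : probability 'rV[R]_d R).

(* H = H_k^d *)
Definition product_dot (f g : {ffun 'I_d -> Hk}) : R :=
  \sum_(i < d) rkhs_dot Hk (f i) (g i).

(* The element of H_k given by the function y |-> d/dx_i k(x, y). *)
Definition partial_section (i : 'I_d) (x : 'rV[R]_d) : Hk :=
  xget 0 [set h : Hk |
    forall y, X y -> rkhs_eval (r := Hk) h y = partial1 i k x y].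

Definition stein_feature (x : 'rV[R]_d) : {ffun 'I_d -> Hk} :=
  [ffun i => score p0 x 0 i *: rkhs_section Hk x + partial_section i x].

Definition stein_kernel (x y : 'rV[R]_d) : R :=
  product_dot (stein_feature x) (stein_feature y).

Definition ksd_V (n : nat) (x : 'I_n -> 'rV[R]_d) : R :=
  dnorm product_dot (n%:R^-1 *: \sum_(i < n) stein_feature (x i)).

Definition stein_cov (v : {ffun 'I_d -> Hk}) : {ffun 'I_d -> Hk} :=
  vexpect product_dot P0 X
    (fun x => rank_one product_dot (stein_feature x) (stein_feature x) v).

End Stein.

Arguments product_dot {R d X k} Hk f g.
Arguments stein_feature {R d X k} Hk p0 x.
Arguments stein_kernel {R d X k} Hk p0 x y.
Arguments ksd_V {R d X k} Hk p0 {n} x.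
Arguments stein_cov {R d X k} Hk p0 P0 v.

Definition effective_rank (R : realType) (V : lmodType R) (dot : V -> V -> R)
    (T : V -> V) : R :=
  fine (optrace dot T) ^+ 2 / fine (optrace dot (T \o T)).

Definition iid_sample (R : realType) (d : nat) (X : set 'rV[R]_d)
    (P0 : probability 'rV[R]_d R) (dO : measure_display)
    (Omega : measurableType dO) (Pr : probability Omega R) (n : nat)
    (x : 'I_n -> Omega -> 'rV[R]_d) : Prop :=
  [/\ forall i, measurable_fun setT (x i),
      forall i w, X (x i w),
      forall i A, measurable A -> Pr (x i @^-1` A) = P0 A
    & forall A : 'I_n -> set 'rV[R]_d, (forall i, measurable (A i)) ->
        Pr (\bigcap_(i in [set: 'I_n]) x i @^-1` A i) =
        (\prod_(i < n) Pr (x i @^-1` A i))%E].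

(* a and b are equivalent up to the factor C, in both directions. *)
Definition asymp (R : realType) (C a b : R) : Prop := a <= C * b /\ b <= C * a.

(* Main.v *)
(* Expanding [xi] along a countable orthonormal basis [e_b], the squared norm of
   [sum_i xi (X_i)] is the sum over [b] of [F_b^2], where [F_b] is the sum over
   [i] of the centred i.i.d. variables [<xi (X_i), e_b>]. With [T = tr C], the mean
   of [F_b^2] is [n E <xi, e_b>^2], and these means add up to [n T]; the second
   moment of any partial sum over [b] is at most [n E K^2 + 3 n^2 T^2], hence at
   most [4 n^2 T^2] when [n >= n_0]. A polynomial minorant of the square root turns
   these two moments into [sqrt (n T) / 2 <= E sqrt (sum_b F_b^2) <= sqrt (n T)],
   the upper bound being Jensen's inequality; so the ratio is within a factor 2
   of [sqrt T / tr (C^2)^(1/4)]. Continuity of the kernel makes the RKHS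
   separable, which is what makes the basis countable. *)

From HB Require Import structures.
From mathcomp Require Import finmap measurable_realfun ring lra.
Require Import Defs.

Set Implicit Arguments.
Unset Strict Implicit.
Unset Printing Implicit Defensive.

Local Open Scope classical_set_scope.
Local Open Scope ring_scope.

(** * Hilbert spaces given by a form *)

(** Completeness is phrased through squared distances only, so that it passes to a finite product of
    spaces without choosing a norm on the product. *)
Record hilbert_form (R : realType) (V : lmodType R) (dot : V -> V -> R) :
    Prop := HilbertForm {
  hdotC : forall u v, dot u v = dot v u ;
  hdotDl : forall u v w, dot (u + v) w = dot u w + dot v w ;
  hdotZl : forall a u v, dot (a *: u) v = a * dot u v ;
  hdot_ge0 : forall u, 0 <= dot u u ;
  hdot_eq0 : forall u, dot u u = 0 -> u = 0 ;
  hdot_complete : forall u : nat -> V,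
    (forall e, 0 < e -> exists N, forall m n, (N <= m)%N -> (N <= n)%N ->
      dot (u m - u n) (u m - u n) < e) ->
    exists l, dot (u n - l) (u n - l) @[n --> \oo] --> (0 : R) }.

Section HilbertForm.
Variables (R : realType) (V : lmodType R) (dot : V -> V -> R).
Hypothesis hd : hilbert_form dot.

Lemma hdotDr u v w : dot u (v + w) = dot u v + dot u w.
Proof. by rewrite (hdotC hd) (hdotDl hd) !(hdotC hd _ u). Qed.

Lemma hdotZr a u v : dot u (a *: v) = a * dot u v.
Proof. by rewrite (hdotC hd) (hdotZl hd) (hdotC hd). Qed.

Lemma hdot0l v : dot 0 v = 0.
Proof. by rewrite -(scale0r v) (hdotZl hd) mul0r. Qed.

Lemma hdot0r v : dot v 0 = 0. Proof. by rewrite (hdotC hd) hdot0l. Qed.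

Lemma hdotNl u v : dot (- u) v = - dot u v.
Proof. by rewrite -scaleN1r (hdotZl hd) mulN1r. Qed.

Lemma hdotNr u v : dot u (- v) = - dot u v.
Proof. by rewrite (hdotC hd) hdotNl (hdotC hd). Qed.

Definition hdotE := (hdotDl hd, hdotDr, hdotNl, hdotNr, hdotZl hd, hdotZr).

Lemma hdot_suml I (r : seq I) (P : pred I) (F : I -> V) v :
  dot (\sum_(i <- r | P i) F i) v = \sum_(i <- r | P i) dot (F i) v.
Proof.
by elim/big_rec2: _ => [|i y x _ <-]; rewrite ?hdot0l ?(hdotDl hd).
Qed.

Lemma hdot_CS u v : dot u v ^+ 2 <= dot u u * dot v v.
Proof.
have [v0|v0] := eqVneq (dot v v) 0.
  by rewrite (hdot_eq0 hd v0) !hdot0r expr0n/= mulr0.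
have vp : 0 < dot v v by rewrite lt_neqAle eq_sym v0 (hdot_ge0 hd).
have := hdot_ge0 hd (dot v v *: u - dot u v *: v).
rewrite !hdotE (hdotC hd v u) => h.
rewrite -subr_ge0 -(pmulr_rge0 _ vp); apply: le_trans h _.
by rewrite le_eqVlt; apply/orP; left; apply/eqP; ring.
Qed.

Lemma hdot_cvg (u : nat -> V) l h :
  dot (u n - l) (u n - l) @[n --> \oo] --> (0 : R) ->
  dot (u n) h @[n --> \oo] --> dot l h.
Proof.
move=> ul; apply/cvgrPdist_lt => e e0.
have e2 : 0 < e ^+ 2 / (dot h h + 1).
  by rewrite divr_gt0 ?exprn_gt0// ltr_wpDl ?(hdot_ge0 hd).
move/cvgrPdist_lt : ul => /(_ _ e2); apply: filterS => n.
rewrite sub0r normrN ger0_norm ?(hdot_ge0 hd)// => H.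
rewrite -ltr_sqr ?nnegrE ?normr_ge0 ?(ltW e0)// real_normK ?num_real//.
rewrite -sqrrN opprB -hdotNl -hdotDl //.
apply: le_lt_trans (hdot_CS _ _) _.
have h0 := hdot_ge0 hd h.
have := H; rewrite ltr_pdivlMr ?ltr_wpDl// => {}H; apply: le_lt_trans H.
by rewrite ler_wpM2l ?(hdot_ge0 hd)// lerDl.
Qed.

(* Minimise [dot h h - 2 L h]: the parallelogram law makes a minimising sequence
   Cauchy. *)
Lemma riesz (L : V -> R) (M : R) : 0 <= M ->
  (forall u v, L (u + v) = L u + L v) -> (forall a u, L (a *: u) = a * L u) ->
  (forall u, L u ^+ 2 <= M * dot u u) ->
  exists m, forall h, dot m h = L h.
Proof.
move=> M0 LD LZ LM.
pose phi h := dot h h - 2 * L h.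
have phi_lb h : - M <= phi h.
  have h0 := hdot_ge0 hd h; have LMh := LM h.
  rewrite /phi.
  (* By [LM] the left side is at most [4 * M * dot h h], which is below the square by AM-GM. *)
  have : (2 * L h) ^+ 2 <= (M + dot h h) ^+ 2.
    have : 0 <= (M - dot h h) ^+ 2 by exact: sqr_ge0.
    nra.
  by have [|? ?] := lerP (2 * L h) (M + dot h h); [lra|nra].
have hasI : has_inf (range phi).
  split; first by exists (phi 0), 0.
  by exists (- M) => _ [h _ <-].
pose I := inf (range phi).
have Ile h : I <= phi h by apply: ge_inf; [exact: (hasI.2)|exists h].
have near_I n : exists h, phi h < I + n.+1%:R^-1.
  have n0 : 0 < n.+1%:R^-1 :> R by rewrite invr_gt0.
  have [_ [h _ <-] hlt] := inf_adherent n0 hasI.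
  by exists h.
have [u uI] := choice near_I.
have upair m n : dot (u m - u n) (u m - u n) <= 2 * (m.+1%:R^-1 + n.+1%:R^-1).
  have := Ile (2^-1 *: (u m + u n)); have := uI m; have := uI n.
  rewrite /phi !LZ !LD !hdotE (hdotC hd (u n) (u m)).
  move: (m.+1%:R^-1) (n.+1%:R^-1) => em en *; lra.
have [|l ul] := hdot_complete hd (u := u).
  move=> e e0.
  have [N HN] : exists N : nat, N.+1%:R^-1 < e / 4.
    exists (Num.truncn (e / 4)^-1); rewrite invf_plt ?posrE ?divr_gt0//.
    by rewrite truncnS_gt.
  exists N => m n Nm Nn; apply: le_lt_trans (upair m n) _.
  have lem k : (N <= k)%N -> k.+1%:R^-1 <= N.+1%:R^-1 :> R.
    by move=> Nk; rewrite lef_pV2 ?posrE// ler_nat.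
  have := lem _ Nm; have := lem _ Nn.
  by move: HN; move: (m.+1%:R^-1) (n.+1%:R^-1) (N.+1%:R^-1) => *; lra.
exists l => h; apply/eqP; rewrite -subr_eq0; apply/eqP.
pose c := dot l h - L h.
(* First-order condition at the minimiser: [phi (u n + t *: h)] is at least [I] while [phi (u n)] is
   within [n.+1%:R^-1] of [I]; then [n] tends to infinity. *)
have key t : 0 <= t ^+ 2 * dot h h + 2 * t * c.
  have le_n n :
      0 <= n.+1%:R^-1 + t ^+ 2 * dot h h + 2 * t * (dot (u n) h - L h).
    have := uI n; have := Ile (u n + t *: h).
    rewrite /phi LD LZ !hdotE (hdotC hd h (u n)).
    by move: (n.+1%:R^-1) => *; lra.
  have : n.+1%:R^-1 + t ^+ 2 * dot h h + 2 * t * (dot (u n) h - L h)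
      @[n --> \oo] --> 0 + t ^+ 2 * dot h h + 2 * t * c.
    apply: cvgD; first by apply: cvgD; [exact: cvg_harmonic|exact: cvg_cst].
    by apply: cvgMl_tmp; apply: cvgB; [exact: hdot_cvg|exact: cvg_cst].
  rewrite add0r => H; apply: (cvgr_to_ge H); apply: nearW => n; exact: le_n.
have hh1 : 0 < dot h h + 1 by have := hdot_ge0 hd h; lra.
(* The choice of [t] almost minimises the quadratic, with [+ 1] guarding against [dot h h = 0]. Its
   value is a negative multiple of [c ^+ 2], which forces [c = 0]. *)
have := key (- c / (dot h h + 1)).
have -> : (- c / (dot h h + 1)) ^+ 2 * dot h h + 2 * (- c / (dot h h + 1)) * c =
  - (c / (dot h h + 1)) ^+ 2 * (dot h h + 2) by field; lra.
rewrite mulNr oppr_ge0 pmulr_lle0; last by lra.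
by rewrite real_exprn_even_le0 ?num_real//= mulf_eq0 invr_eq0 (gt_eqF hh1) orbF
  => /eqP.
Qed.

(* Zero vectors are allowed so that finite families can be indexed by [nat]. *)
Definition orthonormal_or0 (e : nat -> V) : Prop :=
  (forall i j, i != j -> dot (e i) (e j) = 0) /\
  (forall i, dot (e i) (e i) = 1 \/ e i = 0).

(** * Orthonormal families: Bessel, Parseval, countability *)

Section Bessel.
Variable e : nat -> V.
Hypothesis one : orthonormal_or0 e.
Variable v : V.

Let s n := \sum_(i < n) dot v (e i) *: e i.
Let a n := \sum_(i < n) dot v (e i) ^+ 2.

Let dot_s n j : dot (s n) (e j) = if (j < n)%N then dot v (e j) else 0.
Proof.
have [e0 e1] := one.
rewrite hdot_suml; case: ifPn => jn.
  rewrite (bigD1 (Ordinal jn))//= big1 ?addr0 => [|i ij].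
    by rewrite hdotE; case: (e1 j) => [->|->]; rewrite ?mulr1 ?hdot0r ?mul0r.
  by rewrite hdotE e0 ?mulr0.
rewrite big1 // => i _; rewrite hdotE e0 ?mulr0//.
by apply: contra jn => /eqP <-.
Qed.

Let dot_sv n : dot v (s n) = a n.
Proof.
rewrite (hdotC hd) hdot_suml; apply: eq_bigr => i _.
by rewrite hdotE (hdotC hd) expr2.
Qed.

Let dot_ss m n : (m <= n)%N -> dot (s m) (s n) = a m.
Proof.
move=> mn; rewrite hdot_suml; apply: eq_bigr => i _.
by rewrite hdotE (hdotC hd (e i)) dot_s (leq_trans (ltn_ord i) mn) expr2.
Qed.

Let dot_subs n : dot (v - s n) (v - s n) = dot v v - a n.
Proof. by rewrite !hdotE (hdotC hd (s n)) dot_sv dot_ss//; lra. Qed.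

Lemma bessel n : \sum_(i < n) dot v (e i) ^+ 2 <= dot v v.
Proof. by rewrite -subr_ge0 -dot_subs (hdot_ge0 hd). Qed.

(** Bessel bounds the nondecreasing sequence [a], so the partial sums [s] are Cauchy. Their limit
    has the coefficients of [v], hence equals [v] by totality, and [dot v (s n) = a n] passes to the
    limit. *)
Lemma parseval : (forall h, (forall i, dot h (e i) = 0) -> h = 0) ->
  (\sum_(i < n) dot v (e i) ^+ 2) @[n --> \oo] --> dot v v.
Proof.
move=> etot.
have andec : nondecreasing_seq a.
  apply/nondecreasing_seqP => n.
  by rewrite /a big_ord_recr/= lerDl sqr_ge0.
have acvg : cvgn a.
  apply: nondecreasing_is_cvgn => //; exists (dot v v) => _ [n _ <-].
  exact: bessel.
have sdist m n : (m <= n)%N -> dot (s n - s m) (s n - s m) = a n - a m.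
  by move=> mn; rewrite !hdotE (hdotC hd (s n) (s m)) !dot_ss//; lra.
have [|l sl] := hdot_complete hd (u := s).
  move=> eps eps0.
  have /cvgrPdist_lt/(_ (eps / 2)) := acvg.
  rewrite divr_gt0// => /(_ isT)[N _ HN].
  exists N => m n Nm Nn.
  have := HN _ Nm; have := HN _ Nn; rewrite /= !ltr_norml.
  move=> /andP[h1 h2] /andP[h3 h4].
  have [mn|/ltnW nm] := leqP m n; last by rewrite sdist//; lra.
  by rewrite -[s m - s n]opprB hdotNl hdotNr opprK sdist//; lra.
have vl : v = l.
  apply/eqP; rewrite -subr_eq0; apply/eqP/etot => j.
  rewrite hdotDl // hdotNl; apply/eqP; rewrite subr_eq0; apply/eqP.
  have := hdot_cvg (h := e j) sl => /cvg_lim <- //.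
  (* The [j]-th coefficient of [s n] is constant once [n > j], hence the shift by [j.+1]. *)
  apply/esym/cvg_lim => //; rewrite -(cvg_shiftn j.+1).
  apply: cvg_near_cst; apply: nearW => n /=.
  by rewrite dot_s addnS ltnS leq_addl.
have := hdot_cvg (h := v) sl; rewrite -vl.
by under eq_fun do rewrite (hdotC hd) dot_sv.
Qed.

End Bessel.

Lemma parseval_series e v : orthonormal_or0 e ->
  (forall h, (forall i, dot h (e i) = 0) -> h = 0) ->
  (\sum_(i <oo) (dot v (e i) ^+ 2)%:E = (dot v v)%:E)%E.
Proof.
move=> one etot; apply/cvg_lim => //.
under eq_fun do rewrite big_mkord sumEFin.
by apply: cvg_EFin; [exact: nearW|exact: parseval].
Qed.

(** Every element of [B] is non-orthogonal to some [v i], and by Bessel only finitely many have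
    squared coefficient above [m.+1%:R^-1]. So [B] is a countable union of finite sets. *)
Lemma orthonormal_countable (B : set V) (v : nat -> V) :
  orthonormal_basis dot B ->
  (forall h, (forall i, dot h (v i) = 0) -> h = 0) -> countable B.
Proof.
move=> [Bon _] vtot.
pose Bim i m := B `&` [set b | m.+1%:R^-1 < dot (v i) b ^+ 2].
have Bfin i m : finite_set (Bim i m).
  apply: contrapT => /infinite_set_fset.
  move=> /(_ (Num.truncn (m.+1%:R * dot (v i) (v i))).+1)[F FB].
  apply/negP; rewrite -ltnNge.
  (* The default [0] pads the enumeration of [F] to an infinite [orthonormal_or0] sequence. *)
  pose e k := nth 0 (enum_fset F) k.
  have Fb k : (k < size F)%N -> Bim i m (e k) by move=> kF; apply/FB/mem_nth.
  have eon : orthonormal_or0 e.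
    split=> [j k jk|j].
      have [jF|jF] := ltnP j (size F); last by rewrite /e nth_default// hdot0l.
      have [kF|kF] := ltnP k (size F); last first.
        by rewrite /e [in X in dot _ X]nth_default// hdot0r.
      rewrite (Bon _ _ (Fb _ jF).1 (Fb _ kF).1) nth_uniq ?(negbTE jk)//.
      exact: fset_uniq.
    have [jF|jF] := ltnP j (size F); last by right; rewrite /e nth_default.
    by left; rewrite (Bon _ _ (Fb _ jF).1 (Fb _ jF).1) eqxx.
  have := bessel eon (v i) (size F).
  apply: contraPltn => Fbig; apply/negP; rewrite -ltNge.
  have : (size F)%:R * m.+1%:R^-1 <= \sum_(j < size F) dot (v i) (e j) ^+ 2.
    rewrite mulr_natl -[X in _ *+ X]card_ord -sumr_const; apply: ler_sum => j _.
    exact/ltW/((Fb _ (ltn_ord j)).2).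
  apply: lt_le_trans; rewrite ltr_pdivlMr// mulrC.
  have := truncnS_gt (m.+1%:R * dot (v i) (v i)).
  by move/lt_le_trans; apply; rewrite ler_nat.
apply: (@sub_countable _ _ _ (\bigcup_i \bigcup_m Bim i m)).
  apply: subset_card_le => b Bb.
  have [i vib] : exists i, dot (v i) b != 0.
    apply: contrapT => /forallNP h.
    have : b = 0.
      apply: vtot => i; rewrite (hdotC hd); apply/eqP.
      by have /negP := h i; rewrite negbK.
    move=> b0; have := Bon _ _ Bb Bb; rewrite eqxx b0 hdot0l => /eqP.
    by rewrite eq_sym oner_eq0.
  exists i => //.
  exists (Num.truncn (dot (v i) b ^+ 2)^-1) => //; split => //=.
  by rewrite invf_plt ?posrE ?truncnS_gt// exprn_even_gt0.
by apply: bigcup_countable => // i _; apply: bigcup_countable => // m _;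
  exact: finite_set_countable.
Qed.

(** An injection into [nat] puts each basis vector at its own index. The remaining indices carry
    [0], which contributes nothing to the series since [F 0 = 0]. *)
Lemma orthonormal_basis_enum (B : set V) : orthonormal_basis dot B ->
  countable B ->
  exists e : nat -> V, [/\ orthonormal_or0 e,
    forall h, (forall i, dot h (e i) = 0) -> h = 0 &
    forall F : V -> \bar R, F 0 = 0%E -> (forall v, 0 <= F v)%E ->
      (\esum_(b in B) F b = \sum_(i <oo) F (e i))%E].
Proof.
move=> [Bon Btot] /countable_injP[f finj].
pose Bn n := [set b | B b /\ f b = n].
pose e n := xget 0 (Bn n).
have eB b : B b -> e (f b) = b.
  move=> Bb; rewrite /e; case: xgetP => [c _ [Bc fc]|/(_ b)]; last by case.
  by apply: finj; rewrite ?inE.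
have eP n : (B (e n) /\ f (e n) = n) \/ e n = 0.
  by rewrite /e; case: xgetP => [c _ [Bc fc]|_]; [left|right].
exists e; split.
- split=> [i j ij|i].
    case: (eP i) => [[Bi fi]|->]; last by rewrite hdot0l.
    case: (eP j) => [[Bj fj]|->]; last by rewrite hdot0r.
    rewrite Bon//; case: eqP => // eij.
    by move: ij; rewrite -fi -fj eij eqxx.
  case: (eP i) => [[Bi fi]|->]; [left|by right].
  by rewrite Bon// eqxx.
- by move=> h he; apply: Btot => b Bb; rewrite -(eB _ Bb).
- move=> F F0 Fge0.
  pose P := [set n | B (e n) /\ f (e n) = n].
  have -> : B = e @` P.
    apply/seteqP; split=> [b Bb|_ [n [Bn' _] <-]//].
    by exists (f b); rewrite /P/= ?eB.
  rewrite esum_image; last first.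
    by move=> i j; rewrite !inE => -[_ fi] [_ fj] eij; rewrite -fi -fj eij.
  rewrite esum_mkcond nneseries_esumT//; apply: eq_esum => n _.
  case: ifPn => // /negP; rewrite inE /P/= => nP.
  by case: (eP n) => [//|->].
Qed.

End HilbertForm.

Lemma hilbert_form_ffun (R : realType) (d : nat) (V : lmodType R)
    (dot : V -> V -> R) : hilbert_form dot ->
  hilbert_form (fun f g : {ffun 'I_d -> V} => \sum_(i < d) dot (f i) (g i)).
Proof.
move=> hd; split.
- by move=> f g; apply: eq_bigr => i _; rewrite (hdotC hd).
- by move=> f g h; rewrite -big_split; apply: eq_bigr => i _;
    rewrite ffunE (hdotDl hd).
- by move=> a f g; rewrite mulr_sumr; apply: eq_bigr => i _;
    rewrite ffunE (hdotZl hd).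
- by move=> f; apply: sumr_ge0 => i _; exact: hdot_ge0.
- move=> f /psumr_eq0P f0; apply/ffunP => i; rewrite ffunE.
  by apply: (hdot_eq0 hd); apply: f0 => // j _; exact: hdot_ge0.
- move=> u uC.
  have ge0 (f : {ffun 'I_d -> V}) j : 0 <= dot (f j) (f j) by exact: hdot_ge0.
  have le_sum (f : {ffun 'I_d -> V}) i :
      dot (f i) (f i) <= \sum_(j < d) dot (f j) (f j).
    by rewrite (bigD1 i)//= lerDl; apply: sumr_ge0.
  have lim i : exists l, dot (u n i - l) (u n i - l) @[n --> \oo] --> (0 : R).
    apply: (hdot_complete hd (u := fun n => u n i)) => e /uC[N HN].
    exists N => m n Nm Nn; apply: le_lt_trans (HN m n Nm Nn).
    by have := le_sum (u m - u n) i; rewrite !ffunE.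
  have [l ul] := choice lim; exists [ffun i => l i].
  under eq_fun do under eq_bigr do rewrite !ffunE.
  have : (\sum_(i < d) dot (u n i - l i) (u n i - l i)) @[n --> \oo] -->
      \sum_(i < d) (0 : R).
    by apply: cvg_big => [|i _]; [exact: add_continuous|exact: ul].
  by rewrite big1.
Qed.

(** * The RKHS and its finite power: Hilbert structure and separability *)

Section Rkhs.
Variables (R : realType) (d : nat) (X : set 'rV[R]_d).
Variables (k : 'rV[R]_d -> 'rV[R]_d -> R) (Hk : rkhs X k).

Lemma rkhs_hilbert_form : hilbert_form (rkhs_dot Hk).
Proof.
have C u v : rkhs_dot Hk u v = rkhs_dot Hk v u by rewrite hermC expr0 mul1r.
have D u v w : rkhs_dot Hk (u + v) w = rkhs_dot Hk u w + rkhs_dot Hk v w.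
  by rewrite C linearDr; congr (_ + _); exact: C.
have Z a u v : rkhs_dot Hk (a *: u) v = a * rkhs_dot Hk u v.
  by rewrite C linearZr_LR; congr (_ * _); exact: C.
split => //.
- by move=> u; rewrite rkhs_norm sqr_ge0.
- by move=> u; rewrite rkhs_norm => /eqP; rewrite sqrf_eq0 normr_eq0 => /eqP.
- move=> u uC.
  have /cauchy_cvgP/cvg_ex[l ul] : cauchy (u @ \oo).
    apply/cauchy_ballP => e e0; near_simpl.
    have [N HN] := uC _ (exprn_gt0 2 e0).
    exists ([set n | N <= n]%N, [set n | N <= n]%N).
      by split; exists N.
    move=> [m n] [/= Nm Nn]; rewrite -ball_normE /ball_/=.
    have := HN m n Nm Nn; rewrite rkhs_norm ltr_sqr ?nnegrE//.
    exact: ltW.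
  exists l.
  under eq_fun do rewrite rkhs_norm.
  have ul0 : `|u n - l| @[n --> \oo] --> `|l - l|.
    by apply: cvg_norm; apply: cvgB => //; exact: cvg_cst.
  have := cvgM ul0 ul0; rewrite subrr normr0 mulr0.
  exact.
Qed.

Lemma product_dot_hilbert_form : hilbert_form (product_dot Hk).
Proof. exact: hilbert_form_ffun rkhs_hilbert_form. Qed.

Lemma rat_rV_dense (x : 'rV[R]_d) (A : set 'rV[R]_d) : nbhs x A ->
  exists q : 'rV[rat]_d, A (map_mx ratr q).
Proof.
move=> /nbhs_ballP[e /= e0 xA].
have H i : exists q : rat, `|x 0 i - ratr q| < e.
  have /rat_in_itvoo[q] : x 0 i - e < x 0 i + e by lra.
  rewrite in_itv/= => /andP[h1 h2]; exists q.
  by rewrite ltr_norml; lra.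
have [q qP] := choice H.
exists (\row_i q i); apply: xA; split=> [|i j]; [exact: e0|rewrite ord1 !mxE].
exact: qP.
Qed.

(** The value of [h] at [x] is its product with the difference of the sections at [x] and at a
    nearby rational [y]. By Cauchy-Schwarz its square is at most [dot h h] times
    [k x x - 2 k x y + k y y], which continuity of [k] at the diagonal point makes small. *)
Lemma rkhs_eval_eq0 (h : Hk) : open X -> continuous_on2 X k ->
  (forall q : 'rV[rat]_d, X (map_mx ratr q) ->
     rkhs_dot Hk h (rkhs_section Hk (map_mx ratr q)) = 0) -> h = 0.
Proof.
have hd := rkhs_hilbert_form.
move=> oX ck hq; apply: (@rkhs_ext _ _ _ _ Hk) => x Xx.
rewrite !rkhs_reproducing// (hdot0l hd).
set c := rkhs_dot _ _ _.
have secE y z : X y -> X z ->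
    rkhs_dot Hk (rkhs_section Hk y) (rkhs_section Hk z) = k y z.
  by move=> Xy Xz; rewrite -rkhs_reproducing// rkhs_sectionE.
(* The factor 3 comes from writing the squared distance of the sections as
   [2 (k x x - k x y) - (k x x - k y y)]. *)
have small e : 0 < e -> c ^+ 2 <= rkhs_dot Hk h h * (3 * e).
  move=> e0.
  have /cvgrPdist_lt/(_ _ e0)[[A B] /= [Ax Bx] AB] := ck x x Xx Xx.
  have [q [[Xq Aq] Bq]] :
      exists q : 'rV[rat]_d, ((X `&` A) `&` B) (map_mx ratr q).
    apply: rat_rV_dense; apply: filterI; last exact: Bx.
    apply: filterI; last exact: Ax.
    exact: open_nbhs_nbhs (conj oX Xx).
  set y : 'rV[R]_d := map_mx ratr q in Xq Aq Bq.
  have -> : c = rkhs_dot Hk h (rkhs_section Hk x - rkhs_section Hk y).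
    by rewrite !(hdotE hd) (hq q)// subr0.
  apply: le_trans (hdot_CS hd _ _) _.
  apply: ler_wpM2l; first exact: hdot_ge0.
  rewrite !(hdotE hd) !secE//.
  have kyx : k y x = k x y by rewrite -!secE// (hdotC hd).
  rewrite kyx.
  have /= := AB (x, y) (conj (nbhs_singleton Ax) Bq).
  have /= := AB (y, y) (conj Aq Bq).
  by rewrite !ltr_norml => /andP[h1 h2] /andP[h3 h4]; lra.
have hh : 0 < rkhs_dot Hk h h + 1 by have := hdot_ge0 hd h; lra.
apply/eqP; rewrite -sqrf_eq0 eq_le sqr_ge0 andbT.
apply/ler_addgt0Pr => e e0; rewrite add0r.
apply: le_trans (small (e / (3 * (rkhs_dot Hk h h + 1))) _) _.
  by rewrite divr_gt0// mulr_gt0.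
have -> : rkhs_dot Hk h h * (3 * (e / (3 * (rkhs_dot Hk h h + 1)))) =
    e * (rkhs_dot Hk h h / (rkhs_dot Hk h h + 1)) by field; lra.
rewrite ler_piMr ?(ltW e0)// ler_pdivrMr// mul1r; lra.
Qed.

(** The total family consists of the sections at rational points placed in a single coordinate.
    Pairs are indexed through [unpickle], with [0] at the numbers that code no pair. *)
Lemma product_rkhs_separable : open X -> continuous_on2 X k ->
  exists v : nat -> {ffun 'I_d -> Hk},
    forall h, (forall n, product_dot Hk h (v n) = 0) -> h = 0.
Proof.
have hd := rkhs_hilbert_form.
move=> oX ck.
pose w (p : 'rV[rat]_d * 'I_d) : {ffun 'I_d -> Hk} :=
  [ffun j => if j == p.2 then rkhs_section Hk (map_mx ratr p.1) else 0].
exists (fun n => if choice.unpickle n is Some p then w p else 0) => h hv.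
apply/ffunP => i; rewrite ffunE; apply: rkhs_eval_eq0 => // q Xq.
have := hv (choice.pickle (q, i)); rewrite choice.pickleK.
rewrite /product_dot (bigD1 i)//= big1 ?addr0 ?ffunE ?eqxx// => j ji.
by rewrite ffunE/= (negbTE ji) (hdot0r hd).
Qed.

End Rkhs.

(** * Independence and moments *)

Section Independence.
Context d (T : measurableType d) (R : realType) (P : probability T R).

(** Pi-lambda argument: for fixed [B], both sides are finite measures in [A] that agree on the
    pi-system [G]. *)
Lemma independent_g_sigma_algebra (G : set (set T)) (B : set T) :
  G `<=` measurable -> setI_closed G -> G setT -> measurable B ->
  (forall A, G A -> P (A `&` B) = P A * P B)%E ->
  forall A, <<s G >> A -> (P (A `&` B) = P A * P B)%E.
Proof.
move=> Gm GI GT mB GB A sA.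
have PB : (fine (P B))%:E = P B by rewrite fineK// fin_num_measure.
have PB0 : 0 <= fine (P B) by rewrite fine_ge0.
have : mrestr P mB A = mscale (NngNum PB0) P A.
  apply: (@g_sigma_algebra_measure_unique _ _ _ G Gm (fun=> setT)) => //.
  - by apply/seteqP; split => // t _; exists 0%N.
  - move=> C GC; rewrite /mrestr/= /mscale/= PB muleC; exact: GB.
  - move=> _; apply: le_lt_trans (probability_le1 P _) _; last by rewrite ltry.
    exact: measurableI.
by rewrite /mrestr/= /mscale/= PB muleC.
Qed.

(** Independence on rectangles identifies the joint law of [U] and [V] with the product of their
    laws; Tonelli then gives integrability and Fubini the value. *)
Lemma integrable_Rintegral_independent (U V : T -> R) :
  measurable_fun setT U -> measurable_fun setT V ->
  (forall A B, measurable A -> measurable B ->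
    P (U @^-1` A `&` V @^-1` B) = P (U @^-1` A) * P (V @^-1` B))%E ->
  P.-integrable setT (EFin \o U) -> P.-integrable setT (EFin \o V) ->
  P.-integrable setT (fun w => (U w * V w)%:E) /\
  \int[P]_w (U w * V w) = (\int[P]_w U w) * (\int[P]_w V w).
Proof.
move=> mU mV indep iU iV.
pose U' : {mfun T >-> R} := HB.pack U (isMeasurableFun.Build _ _ _ _ _ mU).
pose V' : {mfun T >-> R} := HB.pack V (isMeasurableFun.Build _ _ _ _ _ mV).
have mUV : measurable_fun setT (fun w => (U w, V w)).
  exact: measurable_fun_pair.
pose W : {mfun T >-> (R * R)%type} :=
  HB.pack (fun w => (U w, V w)) (isMeasurableFun.Build _ _ _ _ _ mUV).
pose pU := distribution P U'; pose pV := distribution P V'.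
have WE (f : (R * R)%type -> \bar R) :
    (\int[distribution P W]_z f z = \int[(pU \x pV)%E]_z f z)%E.
  apply: eq_measure_integral => A mA _.
  apply/esym.
  apply: (@product_measure_unique _ _ _ _ _ pU pV) => [B C mB mC|]; last exact: mA.
  exact: (indep B C).
have iU' : pU.-integrable setT EFin.
  by apply: integrable_pushforward => //; exact: measurable_EFinP.
have iV' : pV.-integrable setT EFin.
  by apply: integrable_pushforward => //; exact: measurable_EFinP.
pose M (z : (R * R)%type) : \bar R := (z.1 * z.2)%:E.
have mM : measurable_fun [set: (R * R)%type] M.
  by apply/measurable_EFinP; apply: measurable_funM.
have iM : (pU \x pV)%E.-integrable setT M.
  apply/integrable12ltyP => //=.
  rewrite (_ : (\int[_]_x _)%E =
      (\int[pU]_a (`|a%:E| * \int[pV]_b `|b%:E|))%E); last first.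
    apply: eq_integral => a _.
    under eq_integral => b _ do rewrite normrM EFinM.
    by rewrite ge0_integralZl//; exact: measurableT_comp.
  rewrite ge0_integralZr//; last by apply: integral_ge0.
    move/integrableP : iU' => [_ fU]; move/integrableP : iV' => [_ fV].
    apply: lte_mul_pinfty => //; first exact: integral_ge0.
    by rewrite ge0_fin_numE//; exact: integral_ge0.
  exact: measurableT_comp.
have iUV : P.-integrable setT (fun w => (U w * V w)%:E).
  apply/integrableP; split.
    by apply/measurable_EFinP; exact: measurable_funM.
  move/integrableP : iM => [_]; rewrite -WE ge0_integral_distribution//.
  exact: measurableT_comp.
split=> //; rewrite /Rintegral.
have -> : (\int[P]_w (U w * V w)%:E =
    \int[P]_w (U w)%:E * \int[P]_w (V w)%:E)%E.
  rewrite -[LHS](@integral_distribution _ _ _ _ _ P W M) //.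
  rewrite WE -integral12_prod_meas1//=.
  rewrite -[X in (X * _)%E](@integral_distribution _ _ _ _ _ P U' EFin)//.
  rewrite -[X in (_ * X)%E](@integral_distribution _ _ _ _ _ P V' EFin)//.
  have fV : (\int[pV]_b b%:E)%E \is a fin_num by exact: integrable_fin_num.
  rewrite -(fineK fV) -integralZr//; apply: eq_integral => a _.
  rewrite fineK// -integralZl//; apply: eq_integral => b _.
rewrite fineM//; exact: integrable_fin_num.
Qed.

End Independence.

(** * Calculus of integrable functions with known mean *)

Section HasMean.
Context d (T : measurableType d) (R : realType) (P : probability T R).
Implicit Types (U V : T -> R) (a b c : R).

(** Integrability and value travel together, so that moment computations are assembled term by
    term. *)
Definition has_mean U a : Prop :=
  P.-integrable setT (EFin \o U) /\ \int[P]_w U w = a.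

Lemma has_mean_measurable U a : has_mean U a -> measurable_fun setT U.
Proof. by move=> [/measurable_int/measurable_EFinP]. Qed.

Lemma has_meanE U a : has_mean U a -> (\int[P]_w (U w)%:E)%E = a%:E.
Proof.
by move=> [iU <-]; rewrite /Rintegral fineK//; exact: integrable_fin_num.
Qed.

Lemma eq_has_mean U V a : U =1 V -> has_mean U a -> has_mean V a.
Proof. by move=> /funext ->. Qed.

Lemma has_meanD U V a b :
  has_mean U a -> has_mean V b -> has_mean (fun w => U w + V w) (a + b).
Proof.
move=> [iU <-] [iV <-]; split; last by rewrite RintegralD.
by have := integrableD measurableT iU iV.
Qed.

Lemma has_meanZ c U a : has_mean U a -> has_mean (fun w => c * U w) (c * a).
Proof.
move=> [iU <-]; split; last by rewrite RintegralZl.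
by have := integrableZl measurableT c iU.
Qed.

Lemma has_mean_cst c : has_mean (fun=> c) c.
Proof.
split; first exact: finite_measure_integrable_cst.
rewrite Rintegral_cst// [X in fine X](_ : _ = 1%E) ?mulr1//.
exact: probability_setT.
Qed.

Lemma has_mean_sum I (r : seq I) (Q : pred I) (U : I -> T -> R) (a : I -> R) :
  (forall i, Q i -> has_mean (U i) (a i)) ->
  has_mean (fun w => \sum_(i <- r | Q i) U i w) (\sum_(i <- r | Q i) a i).
Proof.
move=> H; elim: r => [|i r IH].
  rewrite big_nil; under [fun w => _]funext do rewrite big_nil.
  exact: has_mean_cst.
rewrite big_cons; under [fun w => _]funext do rewrite big_cons.
by case: ifP => // Qi; apply: has_meanD => //; exact: H.
Qed.

Lemma has_mean_le U V a b :
  has_mean U a -> has_mean V b -> (forall w, U w <= V w) -> a <= b.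
Proof. by move=> [iU <-] [iV <-] UV; apply: le_Rintegral. Qed.

Lemma integrable_has_mean U V :
  measurable_fun setT U -> P.-integrable setT (EFin \o V) ->
  (forall w, `|U w| <= V w) -> has_mean U (\int[P]_w U w).
Proof.
move=> mU iV UV; split => //; apply: le_integrable iV => //.
  exact/measurable_EFinP.
by move=> w _ /=; rewrite lee_fin (le_trans (UV w))// ler_norm.
Qed.

(** With [M] the maximum of 1, [|U|] and [|V|], the monomial is at most [M ^+ 4], hence at most
    [1 + U ^+ 4 + V ^+ 4]. *)
Lemma has_mean_monomial U V a b i j : (i + j <= 4)%N ->
  measurable_fun setT U -> measurable_fun setT V ->
  has_mean (fun w => U w ^+ 4) a -> has_mean (fun w => V w ^+ 4) b ->
  has_mean (fun w => U w ^+ i * V w ^+ j) (\int[P]_w (U w ^+ i * V w ^+ j)).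
Proof.
move=> ij mU mV U4 V4.
apply: (@integrable_has_mean _ (fun w => 1 + U w ^+ 4 + V w ^+ 4)).
- by apply: measurable_funM; exact: measurable_funX.
- by have [] := has_meanD (has_meanD (has_mean_cst 1) U4) V4.
- move=> w; pose M := Num.max 1 (Num.max `|U w| `|V w|).
  have M1 : 1 <= M by rewrite le_max lexx.
  have UM : `|U w| <= M by rewrite !le_max lexx orbT.
  have VM : `|V w| <= M by rewrite !le_max lexx !orbT.
  rewrite normrM !normrX.
  apply: (@le_trans _ _ (M ^+ 4)).
    apply: (@le_trans _ _ (M ^+ (i + j))); last exact: ler_weXn2l.
    by rewrite exprD; apply: ler_pM; rewrite ?exprn_ge0// lerXn2r// nnegrE
      ?(le_trans _ UM) ?(le_trans _ VM).
  have U0 : 0 <= U w ^+ 4 by rewrite exprn_even_ge0.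
  have V0 : 0 <= V w ^+ 4 by rewrite exprn_even_ge0.
  have nE (z : R) : `|z| ^+ 4 = z ^+ 4.
    by rewrite -normrX ger0_norm// exprn_even_ge0.
  rewrite /M; case: (leP 1) => _; last by rewrite expr1n; lra.
  by case: (leP `|U w|) => _; rewrite nE; lra.
Qed.

End HasMean.

(** * Second and fourth moments of sums over an i.i.d. sample *)

Section Sample.
Context dT (T : measurableType dT) dE (E : measurableType dE) (R : realType).
Variables (P : probability T R) (Q : probability E R) (n : nat).
Variable x : 'I_n -> T -> E.
Hypothesis mx : forall i, measurable_fun setT (x i).
Hypothesis lawx : forall i A, measurable A -> P (x i @^-1` A) = Q A.
Hypothesis indepx : forall A : 'I_n -> set E, (forall i, measurable (A i)) ->
  P (\bigcap_(i in [set: 'I_n]) x i @^-1` A i) =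
  (\prod_(i < n) P (x i @^-1` A i))%E.

Lemma has_mean_sample i h a : has_mean Q h a -> has_mean P (h \o x i) a.
Proof.
move=> hh; have mh := has_mean_measurable hh; have [ih <-] := hh.
pose xi : {mfun T >-> E} :=
  HB.pack (x i) (isMeasurableFun.Build _ _ _ _ _ (mx i)).
have lawE (f : E -> \bar R) :
    (\int[distribution P xi]_z f z = \int[Q]_z f z)%E.
  by apply: eq_measure_integral => A mA _; exact: lawx.
have ihx : P.-integrable setT (EFin \o (h \o x i)).
  apply/integrableP; split.
    by apply/measurable_EFinP; exact: measurableT_comp.
  move/integrableP : ih => [mh' ]; rewrite -lawE ge0_integral_distribution//.
  exact: measurableT_comp.
split=> //; rewrite /Rintegral -[in RHS]lawE integral_distribution//.
exact/measurable_EFinP.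
Qed.

(** The cylinder events constraining only the sample points of index below [m]: a pi-system
    generating the history before [x m]. *)
Let past (m : nat) : set (set T) :=
  [set \bigcap_(i in [set: 'I_n]) x i @^-1` A i | A in
    [set A : 'I_n -> set E | (forall i, measurable (A i)) /\
                             (forall i : 'I_n, (m <= i)%N -> A i = setT)]].

Let pastT m : past m setT.
Proof.
exists (fun=> setT); first by split.
by apply/seteqP; split.
Qed.

Let past_measurable m : past m `<=` measurable.
Proof.
move=> _ [A [mA _] <-]; apply: fin_bigcap_measurable => //= i _.
by rewrite -[X in measurable X]setTI; exact: mx.
Qed.

Let pastI m : setI_closed (past m).
Proof.
move=> _ _ [A [mA At] <-] [B [mB Bt] <-]; exists (fun i => A i `&` B i).
  split=> i; first exact: measurableI.
  by move=> mi; rewrite At// Bt// setIT.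
by rewrite bigcapI.
Qed.

Let past_sample m (i : 'I_n) : (i < m)%N ->
  measurable_fun setT (x i : g_sigma_algebraType (past m) -> E).
Proof.
move=> im _ B mB; rewrite setTI; apply: sub_sigma_algebra.
exists (fun j => if j == i then B else setT).
  split=> j; first by case: ifP.
  by case: eqP => // -> /leq_ltn_trans/(_ im); rewrite ltnn.
apply/seteqP; split=> [w /(_ i I)|w Bw j _] /=; first by rewrite eqxx.
by case: eqP => [->|].
Qed.

(** On a generating cylinder the slot [j] is free, so [B] can be inserted there and the product
    formula [indepx] applied; the rest is the pi-lambda lemma. *)
Let past_independent (j : 'I_n) A B : <<s past j >> A -> measurable B ->
  (P (A `&` x j @^-1` B) = P A * P (x j @^-1` B))%E.
Proof.
move=> sA mB; apply: (independent_g_sigma_algebra (G := past j)) => //.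
- by rewrite -[X in measurable X]setTI; exact: mx.
- move=> _ [C [mC Ct] <-].
  pose C' i := if i == j then B else C i.
  have mC' i : measurable (C' i) by rewrite /C'; case: ifP.
  rewrite (_ : _ `&` _ = \bigcap_(i in [set: 'I_n]) x i @^-1` C' i); last first.
    apply/seteqP; split=> [w [Cw Bw] i _|w Cw]; rewrite /C'/=.
      by case: eqP => [->//|_]; exact: Cw.
    split=> [i _|]; last by have := Cw j I; rewrite /C'/= eqxx.
    have := Cw i I; rewrite /C'/=; case: eqP => // -> _.
    by rewrite Ct.
  rewrite !indepx// (bigD1 j)//= [in RHS](bigD1 j)//= Ct// preimage_setT.
  rewrite probability_setT.
  rewrite mul1e muleC /C' eqxx; congr (_ * _)%E.
  by apply: eq_bigr => i /negbTE ->.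
Qed.

(** This removes the cross terms in the inductions below: the product has mean 0 as soon as either
    the past factor [U] or the new factor [h] is centred. *)
Let has_mean_past (j : 'I_n) U h a b :
  measurable_fun setT (U : g_sigma_algebraType (past j) -> R) ->
  has_mean P U a -> has_mean Q h b ->
  has_mean P (fun w => U w * h (x j w)) (a * b).
Proof.
move=> mU hU hh; have mh := has_mean_measurable hh.
have hx := has_mean_sample j hh.
have [iU Ua] := hU; have [ix xb] := hx.
rewrite -Ua -xb; apply: integrable_Rintegral_independent => //.
- exact: has_mean_measurable hU.
- exact: has_mean_measurable hx.
- move=> A B mA mB.
  have := past_independent (j := j) (A := U @^-1` A) (B := h @^-1` B).
  rewrite comp_preimage; apply.
    by have := mU measurableT A mA; rewrite setTI.
  by rewrite -[X in measurable X]setTI; exact: mh.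
Qed.

Let psum (f : E -> R) m w := \sum_(i < n | (i < m)%N) f (x i w).

Let psum0 f w : psum f 0 w = 0. Proof. by rewrite /psum big_pred0. Qed.

Let psumS f (j : 'I_n) w : psum f j.+1 w = psum f j w + f (x j w).
Proof.
rewrite /psum (bigD1 j)//= addrC; congr (_ + _); apply: eq_bigl => i.
by rewrite ltnS ltn_neqAle andbC.
Qed.

Let psum_past f m : measurable_fun setT f ->
  measurable_fun setT (psum f m : g_sigma_algebraType (past m) -> R).
Proof.
move=> mf; rewrite /psum; under [fun w => _]funext do rewrite big_mkcond.
apply: measurable_sum => i; have [im|im] := boolP (i < m)%N; last first.
  exact: measurable_cst.
by apply: measurableT_comp => //; exact: past_sample.
Qed.

Let psum_measurable f m : measurable_fun setT f ->
  measurable_fun setT (psum f m).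
Proof.
move=> mf; rewrite /psum; under [fun w => _]funext do rewrite big_mkcond.
apply: measurable_sum => i; have [im|im] := boolP (i < m)%N; last first.
  exact: measurable_cst.
exact: measurableT_comp.
Qed.

Let psum_n f w : psum f n w = \sum_(i < n) f (x i w).
Proof. by apply: eq_bigl => i; rewrite ltn_ord. Qed.

(** Induction on [m]: in the square of the past sum plus a new term, the cross term has mean 0. *)
Let has_mean_psum f a m :
  has_mean Q f 0 -> has_mean Q (fun z => f z ^+ 2) a -> (m <= n)%N ->
  has_mean P (psum f m) 0 /\ has_mean P (fun w => psum f m w ^+ 2) (m%:R * a).
Proof.
move=> f1 f2; have mf := has_mean_measurable f1.
elim: m => [_|m IH mn].
  split; [apply: (eq_has_mean (U := fun=> 0))|
          apply: (eq_has_mean (U := fun=> 0))].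
  - by move=> w; rewrite psum0.
  - exact: has_mean_cst.
  - by move=> w; rewrite psum0 expr0n.
  - by rewrite mul0r; exact: has_mean_cst.
pose j := Ordinal mn; have [F1 F2] := IH (ltnW mn).
have mF := @psum_past f j mf.
split.
  have := has_meanD F1 (has_mean_sample j f1); rewrite addr0.
  by apply: eq_has_mean => w /=; rewrite (psumS f j).
have := has_meanD (has_meanD F2 (has_meanZ 2 (has_mean_past mF F1 f1)))
  (has_mean_sample j f2).
have -> : m%:R * a + 2 * (0 * 0) + a = m.+1%:R * a by rewrite -natr1; ring.
by apply: eq_has_mean => w /=; rewrite (psumS f j); ring.
Qed.

(** Only finiteness matters: it yields the integrability of the mixed monomials in the partial
    sums. *)
Let psum_pow4 f c m : has_mean Q (fun z => f z ^+ 4) c ->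
  measurable_fun setT f -> (m <= n)%N ->
  exists r, has_mean P (fun w => psum f m w ^+ 4) r.
Proof.
move=> f4 mf; elim: m => [_|m IH mn].
  exists 0; apply: (eq_has_mean (U := fun=> 0)); last exact: has_mean_cst.
  by move=> w; rewrite psum0 expr0n.
have [r Hr] := IH (ltnW mn); pose j := Ordinal mn.
have [i8 _] := has_meanZ 8 (has_meanD Hr (has_mean_sample j f4)).
exists (\int[P]_w (psum f m.+1 w ^+ 4)).
apply: integrable_has_mean i8 _.
  by apply: measurable_funX; exact: psum_measurable.
move=> w; rewrite (psumS f j)/=; set u := psum f m w; set v := f _.
rewrite ger0_norm ?exprn_even_ge0// -subr_ge0.
have -> : 8 * (u ^+ 4 + v ^+ 4) - (u + v) ^+ 4 =
  (u - v) ^+ 2 * (7 * u ^+ 2 + 10 * u * v + 7 * v ^+ 2) by ring.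
apply: mulr_ge0; first exact: sqr_ge0.
(* The remaining factor is [5 (u + v)^2 + 2 u^2 + 2 v^2]. *)
have : 0 <= (u + v) ^+ 2 by exact: sqr_ge0.
have : 0 <= u ^+ 2 by exact: sqr_ge0.
have : 0 <= v ^+ 2 by exact: sqr_ge0.
nra.
Qed.

Lemma has_mean_sum2 f a : has_mean Q f 0 -> has_mean Q (fun z => f z ^+ 2) a ->
  has_mean P (fun w => (\sum_(i < n) f (x i w)) ^+ 2) (n%:R * a).
Proof.
move=> f1 f2; have [_] := has_mean_psum f1 f2 (leqnn n).
by apply: eq_has_mean => w /=; rewrite psum_n.
Qed.

(* In the expansion of [(F + f)^2 (G + g)^2] the term [4FGfg] is absorbed by
   [2F^2g^2 + 2f^2G^2], so that only one-sided centred factors remain. *)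
Lemma has_mean_sum4 f g a b c f4 g4 :
  has_mean Q f 0 -> has_mean Q g 0 ->
  has_mean Q (fun z => f z ^+ 2) a -> has_mean Q (fun z => g z ^+ 2) b ->
  has_mean Q (fun z => f z ^+ 2 * g z ^+ 2) c ->
  has_mean Q (fun z => f z ^+ 4) f4 -> has_mean Q (fun z => g z ^+ 4) g4 ->
  exists2 r, has_mean P (fun w =>
      (\sum_(i < n) f (x i w)) ^+ 2 * (\sum_(i < n) g (x i w)) ^+ 2) r &
    r <= n%:R * c + 3 * n%:R ^+ 2 * (a * b).
Proof.
move=> f1 g1 f2 g2 fg f4' g4'.
have mf := has_mean_measurable f1; have mg := has_mean_measurable g1.
have ab0 : 0 <= a * b.
  by apply: mulr_ge0; [apply: (has_mean_le (has_mean_cst Q 0) f2)|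
    apply: (has_mean_le (has_mean_cst Q 0) g2)] => z; exact: sqr_ge0.
pose F := psum f; pose G := psum g.
have mF m : measurable_fun setT (F m) by exact: psum_measurable.
have mG m : measurable_fun setT (G m) by exact: psum_measurable.
suff H m : (m <= n)%N ->
  exists2 r, has_mean P (fun w => F m w ^+ 2 * G m w ^+ 2) r &
    r <= m%:R * c + 3 * m%:R ^+ 2 * (a * b).
  have [r Hr rle] := H n (leqnn n); exists r => //.
  by apply: eq_has_mean Hr => w /=; rewrite /F /G !psum_n.
elim: m => [_|m IH mn].
  exists 0; last by rewrite mul0r expr0n/= mulr0 mul0r addr0.
  apply: (eq_has_mean (U := fun=> 0)); last exact: has_mean_cst.
  by move=> w; rewrite /F psum0 expr0n/= mul0r.
have [r Hr rle] := IH (ltnW mn); pose j := Ordinal mn.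
have [F1 F2] := has_mean_psum f1 f2 (ltnW mn).
have [G1 G2] := has_mean_psum g1 g2 (ltnW mn).
have [F4m F4] := psum_pow4 f4' mf (ltnW mn).
have [G4m G4] := psum_pow4 g4' mg (ltnW mn).
have [F4'm F4'] := psum_pow4 f4' mf mn.
have [G4'm G4'] := psum_pow4 g4' mg mn.
have pF := @psum_past f j mf; have pG := @psum_past g j mg.
have FFG := @has_mean_monomial _ _ _ _ _ _ _ _ 2 1 isT (mF m) (mG m) F4 G4.
have FGG := @has_mean_monomial _ _ _ _ _ _ _ _ 1 2 isT (mF m) (mG m) F4 G4.
have ffg := @has_mean_monomial _ _ _ _ _ _ _ _ 2 1 isT mf mg f4' g4'.
have fgg := @has_mean_monomial _ _ _ _ _ _ _ _ 1 2 isT mf mg f4' g4'.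
have FGX := @has_mean_monomial _ _ _ _ _ _ _ _ 2 2 isT (mF m.+1) (mG m.+1) F4' G4'.
exists (\int[P]_w (F m.+1 w ^+ 2 * G m.+1 w ^+ 2)); first exact: FGX.
(* [T1] and [T3] vanish because the new factor is centred, [T4] and [T6] because the past factor is.
   [T2] and [T5] each give [m a b] with weight 3, and [T7] gives [c]. *)
have T1 := has_mean_past
  (measurable_funM (measurable_funX 2 pF) (measurable_funX 1 pG)) FFG g1.
have T2 := has_mean_past (measurable_funX 2 pF) F2 g2.
have T3 := has_mean_past
  (measurable_funM (measurable_funX 1 pF) (measurable_funX 2 pG)) FGG f1.
have T4 := has_mean_past pF F1 fgg.
have T5 := has_mean_past (measurable_funX 2 pG) G2 f2.
have T6 := has_mean_past pG G1 ffg.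
have T7 := has_mean_sample j fg.
have := has_mean_le FGX (has_meanD (has_meanD (has_meanD (has_meanD
  (has_meanD (has_meanD (has_meanD Hr (has_meanZ 2 T1)) (has_meanZ 3 T2))
  (has_meanZ 2 T3)) (has_meanZ 2 T4)) (has_meanZ 3 T5)) (has_meanZ 2 T6)) T7).
move=> /(_ _)/le_trans; apply.
  move=> w; rewrite /F /G (psumS f j) (psumS g j)/=.
  set u := psum f m w; set v := psum g m w; set p := f _; set q := g _.
  have : 0 <= (u * q - p * v) ^+ 2 by exact: sqr_ge0.
  rewrite !expr1; lra.
(* The increment [c + 6 m a b] fits because [3 (m + 1)^2 - 3 m^2 = 6 m + 3]. *)
have t0 : 0 <= m%:R :> R by [].
have := mulr_ge0 t0 ab0; rewrite !(mulr0, mul0r, addr0).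
have S1 : m.+1%:R = m%:R + 1 :> R by rewrite natr1.
rewrite S1; lra.
Qed.

End Sample.

(** * Series of nonnegative functions and the mean of a root *)

Lemma measurable_EFin_series d (T : measurableType d) (R : realType)
    (u : nat -> T -> R) (S : T -> R) :
  (forall b, measurable_fun setT (u b)) -> (forall b w, 0 <= u b w) ->
  (forall w, (\sum_(b <oo) (u b w)%:E = (S w)%:E)%E) -> measurable_fun setT S.
Proof.
move=> mu u_ge0 uS; apply/measurable_EFinP.
have := @ge0_emeasurable_sum _ T R setT (fun b w => (u b w)%:E) xpredT.
under [fun w => (\sum_(i <oo | _) _)%E]funext do rewrite uS.
apply=> b; first by move=> w _ _; rewrite lee_fin.
by move=> _; exact/measurable_EFinP.
Qed.

Lemma ge0_has_mean d (T : measurableType d) (R : realType) (P : probability T R)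
    (U : T -> R) : measurable_fun setT U -> (forall w, 0 <= U w) ->
  (\int[P]_w (U w)%:E < +oo)%E -> has_mean P U (\int[P]_w U w).
Proof.
move=> mU U0 Uoo; split=> //; apply/integrableP; split; first exact/measurable_EFinP.
by under eq_integral => w _ do rewrite gee0_abs ?lee_fin//.
Qed.

Section MeanOfSeries.
Context d (T : measurableType d) (R : realType) (P : probability T R).
Variables (u : nat -> T -> R) (a : nat -> R) (S : T -> R).
Hypothesis u_mean : forall b, has_mean P (u b) (a b).
Hypothesis u_ge0 : forall b w, 0 <= u b w.
Hypothesis uS : forall w, (\sum_(b <oo) (u b w)%:E = (S w)%:E)%E.

Let mean_ge0 b : 0 <= a b.
Proof. by apply: has_mean_le (has_mean_cst P 0) (u_mean b) _. Qed.

Lemma integral_series : (\int[P]_w (S w)%:E = \sum_(b <oo) (a b)%:E)%E.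
Proof.
under eq_integral do rewrite -uS.
rewrite integral_nneseries//.
- by apply: eq_eseriesr => b _; exact: has_meanE.
- by move=> b; apply/measurable_EFinP/has_mean_measurable/u_mean.
- by move=> b w _; rewrite lee_fin.
Qed.

Lemma has_mean_series s : (\sum_(b <oo) (a b)%:E = s%:E)%E -> has_mean P S s.
Proof.
move=> as_.
have <- : \int[P]_w S w = s by rewrite /Rintegral integral_series as_.
apply: ge0_has_mean; last by rewrite integral_series as_ ltry.
  exact: (measurable_EFin_series (fun b => has_mean_measurable (u_mean b))).
by move=> w; rewrite -lee_fin -uS; apply: nneseries_ge0 => b _ _; rewrite lee_fin.
Qed.

Lemma series_has_mean s : has_mean P S s -> (\sum_(b <oo) (a b)%:E = s%:E)%E.
Proof. by move=> /has_meanE; rewrite integral_series. Qed.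

End MeanOfSeries.

Lemma nneseries_EFin_cvg (R : realType) (a : nat -> R) (s : R) :
  (forall b, 0 <= a b) -> (\sum_(b <oo) (a b)%:E = s%:E)%E ->
  (\sum_(b < N) a b) @[N --> \oo] --> s.
Proof.
move=> a0 as_.
have a0' N b : (N <= b)%N -> true -> (0 <= (a b)%:E)%E by rewrite lee_fin.
have : (\sum_(0 <= b < N) (a b)%:E)%E @[N --> \oo] --> s%:E.
  by rewrite -as_; exact: is_cvg_nneseries (a0' 0%N).
move=> /fine_cvg; apply: cvg_trans; apply: near_eq_cvg; apply: nearW => N /=.
by rewrite sumEFin big_mkord.
Qed.

(** The lower bound is proved for the truncation to the first [N] coordinates, where second moments
    are finite sums, and then [N] tends to infinity. The hypothesis on [kappa] encodes the
    sample-size condition. *)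
Lemma iid_series_sqrt_bounds
    dT (T : measurableType dT) dE (E : measurableType dE) (R : realType)
    (P : probability T R) (Q : probability E R) (n : nat) (x : 'I_n -> T -> E)
    (f : nat -> E -> R) (K : E -> R) (S : T -> R) (t kappa : R) :
  (forall i, measurable_fun setT (x i)) ->
  (forall i A, measurable A -> P (x i @^-1` A) = Q A) ->
  (forall A : 'I_n -> set E, (forall i, measurable (A i)) ->
    P (\bigcap_(i in [set: 'I_n]) x i @^-1` A i) =
    (\prod_(i < n) P (x i @^-1` A i))%E) ->
  (forall b, has_mean Q (f b) 0) ->
  (forall z, (\sum_(b <oo) (f b z ^+ 2)%:E = (K z)%:E)%E) ->
  (forall w,
    (\sum_(b <oo) ((\sum_(i < n) f b (x i w)) ^+ 2)%:E = (S w)%:E)%E) ->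
  has_mean Q K t -> has_mean Q (fun z => K z ^+ 2) kappa ->
  0 < t -> kappa <= n%:R * t ^+ 2 -> (0 < n)%N ->
  exists2 L, has_mean P (fun w => Num.sqrt (S w)) L &
    Num.sqrt (n%:R * t) / 2 <= L <= Num.sqrt (n%:R * t).
Proof.
move=> mx lawx indepx f1 fK FS Kt K2 t0 kt n0.
have mf b := has_mean_measurable (f1 b).
have partial_le (u : nat -> R) s N : (forall b, 0 <= u b) ->
    (\sum_(b <oo) (u b)%:E = s%:E)%E -> \sum_(b < N) u b <= s.
  move=> u0 us; rewrite -lee_fin -us -sumEFin -(big_mkord xpredT (fun b => (u b)%:E)).
  by apply: nneseries_lim_ge => b _; rewrite lee_fin.
have fle b z : f b z ^+ 2 <= K z.
  apply: le_trans (partial_le (fun b => f b z ^+ 2) _ b.+1 _ (fK z)).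
    by rewrite big_ord_recr/= lerDr sumr_ge0// => i _; exact: sqr_ge0.
  by move=> c; exact: sqr_ge0.
have K0 z : 0 <= K z by apply: le_trans (fle 0%N z); exact: sqr_ge0.
pose a b := \int[Q]_z (f b z ^+ 2).
have f2 b : has_mean Q (fun z => f b z ^+ 2) (a b).
  apply: integrable_has_mean Kt.1 _; first exact: measurable_funX.
  by move=> z; rewrite ger0_norm ?sqr_ge0.
have mK2 b : measurable_fun setT (fun z => f b z ^+ 2) by exact: measurable_funX.
have at_ : (\sum_(b <oo) (a b)%:E = t%:E)%E.
  by apply: (series_has_mean f2 _ fK Kt) => b z; exact: sqr_ge0.
have a0 b : 0 <= a b.
  by apply: has_mean_le (has_mean_cst Q 0) (f2 b) _ => z; exact: sqr_ge0.
have f22 b c : has_mean Q (fun z => f b z ^+ 2 * f c z ^+ 2)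
    (\int[Q]_z (f b z ^+ 2 * f c z ^+ 2)).
  apply: integrable_has_mean K2.1 _; first exact: measurable_funM.
  move=> z; rewrite ger0_norm; last by apply: mulr_ge0; exact: sqr_ge0.
  rewrite [leRHS]expr2.
  by apply: ler_pM => //; exact: sqr_ge0.
have f4 b : has_mean Q (fun z => f b z ^+ 4) (\int[Q]_z (f b z ^+ 2 * f b z ^+ 2)).
  by apply: eq_has_mean (f22 b b) => z; ring.
pose F b w := \sum_(i < n) f b (x i w).
have F2 b : has_mean P (fun w => F b w ^+ 2) (n%:R * a b).
  exact: (has_mean_sum2 mx lawx indepx).
have S_mean : has_mean P S (n%:R * t).
  apply: (has_mean_series F2) => //; first by move=> b w; exact: sqr_ge0.
  under eq_eseriesr do rewrite EFinM.
  by rewrite nneseriesZl ?at_// => b _; rewrite lee_fin.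
have S0 w : 0 <= S w.
  by rewrite -lee_fin -FS; apply: nneseries_ge0 => b _ _; rewrite lee_fin sqr_ge0.
set c := Num.sqrt (n%:R * t).
have nt0 : 0 < n%:R * t by rewrite mulr_gt0// ltr0n.
have c0 : 0 < c by rewrite sqrtr_gt0.
have c2 : c ^+ 2 = n%:R * t by rewrite sqr_sqrtr// ltW.
have mS : measurable_fun setT (fun w => Num.sqrt (S w)).
  apply: measurableT_comp (has_mean_measurable S_mean).
  by apply: continuous_measurable_fun; exact: sqrt_continuous.
(* Tangent to the square root at [c ^+ 2], the mean of [S]: integrated, it gives both the
   integrability of the root and the upper bound. *)
have sS w : Num.sqrt (S w) <= (2 * c)^-1 * (S w + c ^+ 2).
  rewrite -{2}(sqr_sqrtr (S0 w)) ler_pdivlMl ?mulr_gt0//.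
  have := sqr_ge0 (Num.sqrt (S w) - c); lra.
have up := has_meanZ (2 * c)^-1 (has_meanD S_mean (has_mean_cst P (c ^+ 2))).
have HL : has_mean P (fun w => Num.sqrt (S w)) (\int[P]_w Num.sqrt (S w)).
  apply: integrable_has_mean up.1 _ => // w.
  by rewrite ger0_norm ?sqrtr_ge0.
exists (\int[P]_w Num.sqrt (S w)) => //; set L := Rintegral _ _ _.
apply/andP; split; last first.
  apply: le_trans (has_mean_le HL up sS) _.
  by rewrite -c2 ler_pdivrMl ?mulr_gt0//; lra.
pose SN N w := \sum_(b < N) F b w ^+ 2.
(* This scale maximises [3 mu c^2 - 4 mu^3 c^4], with maximum [c]. *)
pose mu := (2 * c)^-1.
have mu0 : 0 < mu by rewrite invr_gt0 mulr_gt0.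
(* Integrates the minorant [3 mu s - mu^3 s^2] of [2 sqrt s] at [s = SN N w], together with the
   second-moment bound [rN]. *)
have lower N : 3 * mu * (n%:R * \sum_(b < N) a b) -
    mu ^+ 3 * (4 * (n%:R * t) ^+ 2) <= 2 * L.
  have SN_mean : has_mean P (SN N) (n%:R * \sum_(b < N) a b).
    by rewrite mulr_sumr; exact: has_mean_sum.
  pose r b e := \int[P]_w (F b w ^+ 2 * F e w ^+ 2).
  have r_mean b e : has_mean P (fun w => F b w ^+ 2 * F e w ^+ 2) (r b e) /\
      r b e <= n%:R * \int[Q]_z (f b z ^+ 2 * f e z ^+ 2) +
               3 * n%:R ^+ 2 * (a b * a e).
    have [q Hq qle] := has_mean_sum4 mx lawx indepx (f1 b) (f1 e) (f2 b) (f2 e)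
      (f22 b e) (f4 b) (f4 e).
    by rewrite /r Hq.2.
  have SN2_mean : has_mean P (fun w => SN N w ^+ 2)
      (\sum_(b < N) \sum_(e < N) r b e).
    have := @has_mean_sum _ _ _ P _ (index_enum 'I_N) xpredT _ _
      (fun b _ => @has_mean_sum _ _ _ P _ (index_enum 'I_N) xpredT _ _
      (fun e _ => (r_mean b e).1)).
    apply: eq_has_mean => w /=; rewrite /SN expr2 mulr_suml.
    by apply: eq_bigr => b _; rewrite mulr_sumr.
  (* The double sum is the mean of the square of a partial sum of [K]. *)
  have kN : \sum_(b < N) \sum_(e < N) \int[Q]_z (f b z ^+ 2 * f e z ^+ 2) <= kappa.
    have := @has_mean_sum _ _ _ Q _ (index_enum 'I_N) xpredT _ _
      (fun b _ => @has_mean_sum _ _ _ Q _ (index_enum 'I_N) xpredT _ _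
      (fun e _ => f22 b e)).
    move=> /has_mean_le/(_ K2); apply => z.
    under eq_bigr do rewrite -mulr_sumr.
    rewrite -mulr_suml -expr2 ler_sqr ?nnegrE ?sumr_ge0//.
      by apply: (@partial_le (fun b => f b z ^+ 2) _ _ _ (fK z)) => b; exact: sqr_ge0.
    by move=> b _; exact: sqr_ge0.
  have aN : \sum_(b < N) a b <= t by exact: partial_le a0 at_.
  have aN0 : 0 <= \sum_(b < N) a b by exact: sumr_ge0.
  (* The diagonal part is at most [n kappa], hence [(n t)^2] by [kt]; the rest contributes
     [3 (n t)^2]. *)
  have rN : \sum_(b < N) \sum_(e < N) r b e <= 4 * (n%:R * t) ^+ 2.
    apply: (@le_trans _ _ (\sum_(b < N) \sum_(e < N)
      (n%:R * \int[Q]_z (f b z ^+ 2 * f e z ^+ 2) + 3 * n%:R ^+ 2 * (a b * a e)))).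
      by apply: ler_sum => b _; apply: ler_sum => e _; exact: (r_mean b e).2.
    under eq_bigr do rewrite big_split/= -!mulr_sumr.
    rewrite big_split/= -!mulr_sumr -mulr_suml.
    have n1 : 0 <= n%:R :> R by [].
    have := ler_wpM2l n1 kN; have := ler_wpM2l n1 kt.
    have : (\sum_(b < N) a b) * (\sum_(b < N) a b) <= t * t by apply: ler_pM.
    move=> /(ler_wpM2l (sqr_ge0 (n%:R : R))).
    lra.
  have := has_mean_le (has_meanD (has_meanZ (3 * mu) SN_mean)
    (has_meanZ (- mu ^+ 3) SN2_mean)) (has_meanZ 2 HL).
  move=> H; apply: le_trans (H _).
    have := ler_wpM2l (exprn_ge0 3 (ltW mu0)) rN; lra.
  move=> w; have SNS : SN N w <= S w.
    by apply: (@partial_le (fun b => F b w ^+ 2) _ _ _ (FS w)) => b; exact: sqr_ge0.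
  have SN0 : 0 <= SN N w by apply: sumr_ge0 => b _; exact: sqr_ge0.
  have : Num.sqrt (SN N w) <= Num.sqrt (S w) by rewrite ler_sqrt.
  rewrite -{2 3}(sqr_sqrtr SN0); have := sqrtr_ge0 (SN N w).
  move: (Num.sqrt (SN N w)) (Num.sqrt (S w)) => u v u0 uv.
  (* [2y - 3y^2 + y^4 = y (y - 1)^2 (y + 2)] at [y = mu u] *)
  have : 0 <= u * ((mu * u - 1) ^+ 2 * (mu * u + 2)).
    apply: mulr_ge0 => //; apply: mulr_ge0; first exact: sqr_ge0.
    by apply: addr_ge0 => //; apply: mulr_ge0 => //; exact: ltW.
  lra.
have := nneseries_EFin_cvg a0 at_ => aN.
have : 3 * mu * (n%:R * \sum_(b < N) a b) - mu ^+ 3 * (4 * (n%:R * t) ^+ 2)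
    @[N --> \oo] --> 3 * mu * (n%:R * t) - mu ^+ 3 * (4 * (n%:R * t) ^+ 2).
  apply: cvgB; last exact: cvg_cst.
  by apply: cvgMl_tmp; apply: cvgMl_tmp.
have lowerN : \forall N \near \oo, 3 * mu * (n%:R * \sum_(b < N) a b) -
    mu ^+ 3 * (4 * (n%:R * t) ^+ 2) <= 2 * L by exact: nearW.
move=> /cvgr_to_le/(_ lowerN); rewrite -c2.
have -> : 3 * mu * c ^+ 2 - mu ^+ 3 * (4 * (c ^+ 2) ^+ 2) = c.
  by rewrite /mu; field; lra.
lra.
Qed.

(** * The Stein covariance operator *)

Section Covariance.
Context dE (E : measurableType dE) (R : realType) (Q : probability E R).
Variables (V : lmodType R) (dot : V -> V -> R).
Hypothesis hd : hilbert_form dot.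
Variables (xi : E -> V) (t : R).
Hypothesis xi_measurable : forall h, measurable_fun setT (fun z => dot (xi z) h).
Hypothesis xi_mean : has_mean Q (fun z => dot (xi z) (xi z)) t.

Let dot_sq z h : dot (xi z) h ^+ 2 <= dot h h * dot (xi z) (xi z).
Proof. by rewrite mulrC; exact: hdot_CS. Qed.

Let xi_ge0 z : 0 <= dot (xi z) (xi z). Proof. exact: hdot_ge0. Qed.

Lemma has_mean_dotM u h : has_mean Q (fun z => dot (xi z) u * dot (xi z) h)
  (\int[Q]_z (dot (xi z) u * dot (xi z) h)).
Proof.
have [iK _] := has_meanZ (dot u u + dot h h) xi_mean.
apply: integrable_has_mean iK _; first exact: measurable_funM.
move=> z; have := dot_sq z u; have := dot_sq z h.
have := sqr_ge0 (dot (xi z) u - dot (xi z) h).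
have := sqr_ge0 (dot (xi z) u + dot (xi z) h).
have := sqr_ge0 (dot (xi z) u); have := sqr_ge0 (dot (xi z) h).
by rewrite ler_norml => *; apply/andP; split; lra.
Qed.

(** Riesz representation: by Cauchy-Schwarz under the integral, the square of the functional [L] is
    at most [dot u u * t ^+ 2 * dot h h]. *)
Lemma covariance_exists u : exists m, forall h,
  has_mean Q (fun z => dot (xi z) u * dot (xi z) h) (dot m h).
Proof.
pose L h := \int[Q]_z (dot (xi z) u * dot (xi z) h).
have [|||h|m mL] := riesz hd (L := L) (M := dot u u * t ^+ 2).
- by rewrite mulr_ge0 ?sqr_ge0 ?(hdot_ge0 hd).
- move=> h g; rewrite -(has_meanD (has_mean_dotM u h) (has_mean_dotM u g)).2.
  by apply: eq_Rintegral => z _; rewrite (hdotDr hd) mulrDr.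
- move=> a h; rewrite -(has_meanZ a (has_mean_dotM u h)).2.
  by apply: eq_Rintegral => z _; rewrite (hdotZr hd) mulrCA.
- pose c := Num.sqrt (dot u u * dot h h).
  have uh0 : 0 <= dot u u * dot h h by rewrite mulr_ge0 ?(hdot_ge0 hd).
  have c2 : c ^+ 2 = dot u u * dot h h by rewrite sqr_sqrtr.
  have bnd z : `|dot (xi z) u * dot (xi z) h| <= c * dot (xi z) (xi z).
    rewrite -ler_sqr ?nnegrE ?mulr_ge0 ?sqrtr_ge0//.
    rewrite real_normK ?num_real// !exprMn c2.
    have -> : dot u u * dot h h * dot (xi z) (xi z) ^+ 2 =
      (dot u u * dot (xi z) (xi z)) * (dot h h * dot (xi z) (xi z)) by ring.
    by apply: ler_pM; rewrite ?sqr_ge0.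
  have up : L h <= c * t.
    apply: has_mean_le (has_mean_dotM u h) (has_meanZ c xi_mean) _ => z.
    exact: le_trans (ler_norm _) (bnd z).
  have lo : - c * t <= L h.
    apply: has_mean_le (has_meanZ (- c) xi_mean) (has_mean_dotM u h) _ => z.
    by rewrite mulNr lerNl; apply: le_trans (bnd z); rewrite -normrN ler_norm.
  have -> : dot u u * t ^+ 2 * dot h h = (c * t) ^+ 2 by rewrite exprMn c2; ring.
  nra.
- by exists m => h; rewrite mL; exact: has_mean_dotM.
Qed.

Variable C : V -> V.
Hypothesis C_mean : forall u h,
  has_mean Q (fun z => dot (xi z) u * dot (xi z) h) (dot (C u) h).

Lemma covariance_sym u v : dot (C u) v = dot (C v) u.
Proof.
by rewrite -(C_mean u v).2 -(C_mean v u).2; apply: eq_Rintegral => z _; ring.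
Qed.

Lemma covariance_ge0 u : 0 <= dot (C u) u.
Proof.
by apply: has_mean_le (has_mean_cst Q 0) (C_mean u u) _ => z; rewrite -expr2 sqr_ge0.
Qed.

Let covariance_le h : dot (C h) h <= dot h h * t.
Proof.
apply: has_mean_le (C_mean h h) (has_meanZ (dot h h) xi_mean) _ => z.
by rewrite -expr2.
Qed.

(* AM-GM on [dot (xi z) u * dot (xi z) (C u)], with weights [t] and [1 / t]. *)
Lemma covariance_sqr_le u : 0 < t -> dot (C u) (C u) <= t * dot (C u) u.
Proof.
move=> t0.
have amgm z : 2 * t * (dot (xi z) u * dot (xi z) (C u)) <=
    t ^+ 2 * (dot (xi z) u * dot (xi z) u) +
    dot (xi z) (C u) * dot (xi z) (C u).
  have := sqr_ge0 (t * dot (xi z) u - dot (xi z) (C u)); lra.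
have := has_mean_le (has_meanZ (2 * t) (C_mean u (C u)))
  (has_meanD (has_meanZ (t ^+ 2) (C_mean u u)) (C_mean (C u) (C u))) amgm.
(* The last AM-GM term is at most [t * dot (C u) (C u)], which the left side absorbs. *)
have := covariance_le (C u) => h1 h2.
rewrite -(ler_pM2l t0); lra.
Qed.

Variable e : nat -> V.
Hypotheses (one : orthonormal_or0 dot e)
  (etot : forall h, (forall i, dot h (e i) = 0) -> h = 0).

(** Parseval at each point, then Tonelli to exchange sum and mean. *)
Lemma covariance_trace : (\sum_(b <oo) (dot (C (e b)) (e b))%:E = t%:E)%E.
Proof.
apply: (series_has_mean (fun b => C_mean (e b) (e b)) _ _ xi_mean).
  by move=> b z; rewrite -expr2 sqr_ge0.
move=> z; rewrite -(parseval_series hd (xi z) one etot).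
by apply: eq_eseriesr => b _; rewrite expr2.
Qed.

(** Each term is the squared norm of [C (e b)]: it is dominated by [t] times a term of the trace, so
    the sum is finite. As the trace is positive, some [C (e b)] is nonzero, so the sum is
    positive. *)
Lemma covariance_trace_sqr : 0 < t -> exists2 s, 0 < s &
  (\sum_(b <oo) (dot (C (C (e b))) (e b))%:E = s%:E)%E.
Proof.
move=> t0; pose q b := dot (C (C (e b))) (e b).
have qE b : q b = dot (C (e b)) (C (e b)) by rewrite /q covariance_sym.
have q0 b : (0 <= (q b)%:E)%E by rewrite lee_fin qE (hdot_ge0 hd).
have fin : (\sum_(b <oo) (q b)%:E)%E \is a fin_num.
  rewrite ge0_fin_numE ?nneseries_ge0//.
  apply: (@le_lt_trans _ _ (\sum_(b <oo) (t%:E * (dot (C (e b)) (e b))%:E))%E).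
    apply: lee_nneseries => b _ //.
    by rewrite -EFinM lee_fin qE covariance_sqr_le.
  rewrite nneseriesZl ?covariance_trace// -?EFinM ?ltry// => b _.
  by rewrite lee_fin covariance_ge0.
have [b Cb] : exists b, dot (C (e b)) (e b) != 0.
  apply: contrapT => /forallNP H.
  have := covariance_trace; rewrite eseries0 => [[t00]|b _ _].
    by rewrite -t00 ltxx in t0.
  by have /negP := H b; rewrite negbK => /eqP ->.
exists (fine (\sum_(b <oo) (q b)%:E)%E); last by rewrite fineK.
apply: fine_gt0; rewrite ltey_eq fin/= andbT.
apply: (@lt_le_trans _ _ (q b)%:E); last first.
  apply: le_trans (nneseries_lim_ge b.+1 _) => //.
  by rewrite big_nat_recr//= leeDr// sume_ge0.
rewrite lte_fin qE lt_neqAle (hdot_ge0 hd) andbT eq_sym.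
apply: contra Cb => /eqP /(hdot_eq0 hd) ->.
by rewrite (hdot0l hd).
Qed.

End Covariance.

(** * Integrals over the domain, and the comparison of the risk with the benchmark *)

Lemma has_mean_restrict d (T : measurableType d) (R : realType)
    (P : probability T R) (X : set T) (f : T -> R) (a : R) : measurable X ->
  has_mean P (f \_ X) a <->
  P.-integrable X (EFin \o f) /\ \int[P]_(w in X) f w = a.
Proof.
move=> mX; rewrite /has_mean -Rintegral_mkcond -restrict_EFin.
by split=> -[h1 h2]; split=> //; [apply/(integrable_mkcond (EFin \o f) mX)|
  apply/(integrable_mkcond (EFin \o f) mX)].
Qed.

Lemma is_vexpectP d (T : measurableType d) (R : realType)
    (P : probability T R) (X : set T) (V : lmodType R) (dot : V -> V -> R)
    (f : T -> V) (m : V) : measurable X ->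
  is_vexpect dot P X f m <->
  forall h, has_mean P ((fun w => dot (f w) h) \_ X) (dot m h).
Proof.
move=> mX; split=> [H h|H h].
  by apply/has_mean_restrict => //; have [? ->] := H h.
by have /has_mean_restrict := H h; move=> /(_ mX)[? ->].
Qed.

(** Without a basis [xget] returns [set0], over which the trace is 0; a positive trace rules this
    out. *)
Lemma optrace_gt0_basis (R : realType) (V : lmodType R) (dot : V -> V -> R)
    (T : V -> V) : (0 < optrace dot T)%E ->
  orthonormal_basis dot (xget set0 (orthonormal_basis dot)).
Proof.
rewrite /optrace; case: xgetP => [B -> //|].
by rewrite esum_set0 ltxx.
Qed.

Theorem corollary8 (R : realType) :
  exists C : R, 0 < C /\
  forall (d : nat) (X : set 'rV[R]_d)
    (p0 : 'rV[R]_d -> R) (P0 : probability 'rV[R]_d R)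
    (k : 'rV[R]_d -> 'rV[R]_d -> R) (Hk : rkhs X k)
    (dO : measure_display) (Omega : measurableType dO)
    (Pr : probability Omega R) (n : nat) (x : 'I_n -> Omega -> 'rV[R]_d),
  open X ->
  has_density X P0 p0 -> C1_on X p0 -> (forall z, X z -> 0 < p0 z) ->
  pd_kernel X k -> C11_on X k ->
  let dot := product_dot Hk in
  let xi := stein_feature Hk p0 in
  let K := stein_kernel Hk p0 in
  let Cstar := stein_cov Hk p0 P0 in
  let trC := fine (optrace dot Cstar) in
  let trC2 := fine (optrace dot (Cstar \o Cstar)) in
  (\int[P0]_(z in X) (K z z)%:E < +oo)%E ->
  is_vexpect dot P0 X xi 0 ->
  (0 < optrace dot Cstar)%E ->
  (\int[P0]_(z in X) (K z z ^+ 2)%:E < +oo)%E ->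
  iid_sample X P0 Pr x ->
  Num.ceil (\int[P0]_(z in X) (K z z ^+ 2) / trC ^+ 2) <= n%:Z ->
  [/\ 0 < trC2,
      asymp C
        (fine ('E_Pr[fun w => ksd_V Hk p0 (fun i => x i w)]) /
           (trC2 `^ 4^-1 / Num.sqrt n%:R))
        ((trC ^+ 2 / trC2) `^ 4^-1)
    & (trC ^+ 2 / trC2) `^ 4^-1 = effective_rank dot Cstar `^ 4^-1].
Proof.
(* The constant is the loss in the lower bound for the mean of the root. *)
exists 2; split=> // d X p0 P0 k Hk dO Omega Pr n x oX _ _ _ _ [ck _ _ _].
move=> dot xi K Cstar trC trC2 K_lty xi0 trC_gt0 K2_lty [mx xX lawx indepx] nge.
have hd : hilbert_form dot := product_dot_hilbert_form Hk.
have mX : measurable X by exact: sub_sigma_algebra.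
have /(is_vexpectP _ _ _ _ mX) {}xi0 := xi0.
(* Extension by 0 turns integrals over [X] into integrals over the whole space; the sample stays in
   [X], where nothing changes. *)
pose xiX z := if z \in X then xi z else 0.
have xiXE h z : dot (xiX z) h = ((fun z => dot (xi z) h) \_ X) z.
  by rewrite /xiX patchE; case: ifP => // _; rewrite (hdot0l hd).
have xi_mean h : has_mean P0 (fun z => dot (xiX z) h) 0.
  have := xi0 h; rewrite (hdot0l hd); apply: eq_has_mean => z.
  by rewrite xiXE.
have basis := optrace_gt0_basis trC_gt0.
have [v vtot] := product_rkhs_separable Hk oX ck.
have Bcount := orthonormal_countable hd basis vtot.
have [e [one etot esumE]] := orthonormal_basis_enum hd basis Bcount.
have KXE z : dot (xiX z) (xiX z) = ((fun z => K z z) \_ X) z.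
  by rewrite /xiX patchE /K /stein_kernel; case: ifP => // _; rewrite (hdot0l hd).
have KX0 z : 0 <= dot (xiX z) (xiX z) by exact: hdot_ge0.
have mxi h := has_mean_measurable (xi_mean h).
(* Parseval writes the Stein kernel on the diagonal as a series of measurable squares. *)
have mK : measurable_fun setT (fun z => dot (xiX z) (xiX z)).
  apply: (@measurable_EFin_series _ _ _ (fun b z => dot (xiX z) (e b) ^+ 2)).
  - by move=> b; exact: measurable_funX.
  - by move=> b z; exact: sqr_ge0.
  - by move=> z; exact: parseval_series.
pose t := \int[P0]_z dot (xiX z) (xiX z).
have K_mean : has_mean P0 (fun z => dot (xiX z) (xiX z)) t.
  apply: ge0_has_mean => //; apply: le_lt_trans K_lty.
  rewrite [leRHS]integral_mkcond le_eqVlt; apply/orP; left; apply/eqP.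
  by apply: eq_integral => z _; rewrite KXE !patchE; case: ifP.
pose kappa := \int[P0]_(z in X) (K z z ^+ 2).
have K2XE z : dot (xiX z) (xiX z) ^+ 2 = ((fun z => K z z ^+ 2) \_ X) z.
  by rewrite KXE !patchE; case: ifP => // _; rewrite expr0n.
have K2_mean : has_mean P0 (fun z => dot (xiX z) (xiX z) ^+ 2) kappa.
  have -> : kappa = \int[P0]_z (dot (xiX z) (xiX z) ^+ 2).
    by rewrite /kappa Rintegral_mkcond; apply: eq_Rintegral => z _; rewrite K2XE.
  apply: ge0_has_mean => [|z|]; [exact: measurable_funX|exact: sqr_ge0|].
  apply: le_lt_trans K2_lty.
  rewrite [leRHS]integral_mkcond le_eqVlt; apply/orP; left; apply/eqP.
  by apply: eq_integral => z _; rewrite K2XE !patchE; case: ifP.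
(* [stein_cov] selects a weak expectation by [xget]; Riesz shows that one exists, so the selected
   vector is one. *)
have C_mean u h :
    has_mean P0 (fun z => dot (xiX z) u * dot (xiX z) h) (dot (Cstar u) h).
  have : is_vexpect dot P0 X (fun z => rank_one dot (xi z) (xi z) u) (Cstar u).
    apply: xgetPex.
    have [m mP] := covariance_exists hd mxi K_mean u; exists m.
    apply/is_vexpectP => // h'; apply: eq_has_mean (mP h') => z.
    rewrite !xiXE !patchE /rank_one; case: ifP => _; last by rewrite mul0r.
    by symmetry; exact: (hdotZl hd).
  move=> /(is_vexpectP _ _ _ _ mX)/(_ h); apply: eq_has_mean => z.
  rewrite !xiXE !patchE /rank_one; case: ifP => _; last by rewrite mul0r.
  by rewrite (hdotZl hd).
have trCE : optrace dot Cstar = t%:E.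
  rewrite /optrace esumE ?(hdot0r hd)//.
    exact: (covariance_trace hd K_mean C_mean one etot).
  by move=> u; rewrite lee_fin (covariance_ge0 C_mean).
have trCt : trC = t by rewrite /trC trCE.
have t0 : 0 < t by rewrite -lte_fin -trCE.
have [s s0 trC2E] : exists2 s, 0 < s & optrace dot (Cstar \o Cstar) = s%:E.
  have [s s0 sE] := covariance_trace_sqr hd K_mean C_mean one etot t0.
  exists s => //; rewrite /optrace esumE ?(hdot0r hd)//.
  by move=> u; rewrite lee_fin /= (covariance_sym C_mean) (hdot_ge0 hd).
have trC2s : trC2 = s by rewrite /trC2 trC2E.
have kt : kappa <= n%:R * t ^+ 2.
  move: nge; rewrite trCt ceil_le_int -/kappa.
  by rewrite ler_pdivrMr ?exprn_gt0//.
(* Nonnegative variance gives [kappa >= t ^+ 2]. Positivity of [kappa] then excludes [n = 0] through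
   [kt]. *)
have kappa0 : 0 < kappa.
  apply: lt_le_trans (exprn_gt0 2 t0) _; rewrite -subr_ge0.
  have -> : kappa - t ^+ 2 = kappa + - (2 * t) * t + t ^+ 2 by ring.
  apply: has_mean_le (has_mean_cst P0 0) (has_meanD (has_meanD K2_mean
    (has_meanZ (- (2 * t)) K_mean)) (has_mean_cst P0 (t ^+ 2))) _ => z.
  have := sqr_ge0 (dot (xiX z) (xiX z) - t); lra.
have n0 : (0 < n)%N.
  rewrite lt0n; apply/eqP => n_eq0; move: kt.
  by rewrite n_eq0 mul0r leNgt kappa0.
pose M w := \sum_(i < n) xi (x i w).
have xiXx i w h : dot (xiX (x i w)) h = dot (xi (x i w)) h.
  by rewrite /xiX mem_set.
have [L L_mean /andP[Llo Lup]] : exists2 L,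
    has_mean Pr (fun w => Num.sqrt (dot (M w) (M w))) L &
    Num.sqrt (n%:R * t) / 2 <= L <= Num.sqrt (n%:R * t).
  apply: (iid_series_sqrt_bounds (f := fun b z => dot (xiX z) (e b)) mx lawx
    indepx _ _ _ K_mean K2_mean t0 kt n0) => [b|z|w].
  - exact: xi_mean.
  - exact: parseval_series.
  - rewrite -(parseval_series hd (M w) one etot); apply: eq_eseriesr => b _.
    rewrite (hdot_suml hd); congr ((_ ^+ 2)%:E).
    by apply: eq_bigr => i _; rewrite xiXx.
have n0R : 0 < n%:R :> R by rewrite ltr0n.
have EL : fine ('E_Pr[fun w => ksd_V Hk p0 (fun i => x i w)])%E = n%:R^-1 * L.
  rewrite unlock -/(Rintegral Pr setT _) -(has_meanZ n%:R^-1 L_mean).2.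
  apply: eq_Rintegral => w _; rewrite /ksd_V /dnorm -/dot -/xi -/(M w).
  rewrite (hdotZl hd) (hdotZr hd) mulrA -expr2 sqrtrM ?sqr_ge0//.
  by rewrite sqrtr_sqr ger0_norm// invr_ge0 ler0n.
split=> //; first by rewrite trC2s.
rewrite EL trCt trC2s.
pose tau := s `^ 4^-1.
have tau0 : 0 < tau by exact: powR_gt0.
(* Both sides of the comparison thus share the factor [tau^-1], and only [L / sqrt n] against
   [sqrt t] remains. *)
have target : (t ^+ 2 / s) `^ 4^-1 = Num.sqrt t / tau.
  rewrite powRM ?exprn_ge0 ?invr_ge0 ?(ltW s0) ?(ltW t0)//.
  rewrite -powR_mulrn ?(ltW t0)// -powRrM.
  have -> : 2%:R * 4^-1 = 2^-1 :> R by field.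
  rewrite powR12_sqrt ?(ltW t0)//; congr (_ * _).
  have -> : s^-1 = s `^ (-1) by rewrite powR_inv1 ?(ltW s0).
  by rewrite -powRrM mulN1r powRN.
have sn0 : 0 < Num.sqrt n%:R :> R by rewrite sqrtr_gt0.
rewrite target -/tau.
have -> : n%:R^-1 * L / (tau / Num.sqrt n%:R) = L / Num.sqrt n%:R / tau.
  have := sqr_sqrtr (ltW n0R); move: sn0.
  move: (Num.sqrt n%:R) => r r0 <-.
  by field; rewrite !gt_eqF.
rewrite sqrtrM ?ler0n// in Llo Lup.
have LE : L / Num.sqrt n%:R <= Num.sqrt t by rewrite ler_pdivrMr// mulrC.
have GE : Num.sqrt t <= 2 * (L / Num.sqrt n%:R).
  by rewrite mulrA ler_pdivlMr// mulrC; lra.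
split; rewrite mulrA ler_pM2r ?invr_gt0//; lra.
Qed.
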